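(* Let $d, N$ be positive integers and let $\mathcal A = (A_1, \dotsc, A_N) \in \mathcal M_d(\mathbb R)^N$. Then the following statements are equivalent: (a) $\rho_{\mathrm d}(\mathcal A) = \rho_{\mathrm p}(\mathcal A)$. (b) There exist pairwise distinct $i_1, \dotsc, i_k \in \{1,\dotsc,N\}$ (with $k \ge 1$) such that $\rho_{\mathrm d}(\mathcal A) = \rho(A_{i_k} \dotsm A_{i_1})^{1/k}$.
   Context: $\mathcal M_n(\mathbb R)$ is the space of $n\times n$ real matrices; $\rho(M)$ is the spectral radius of $M$; $\|\cdot\|$ is any norm on $\mathcal M_d(\mathbb R)$ induced by a norm on $\mathbb R^d$ (the quantities below do not depend on this choice). A matrix $P = (p_{ij})_{1\le i,j\le N}$ with nonnegative entries is stochastic if $\sum_{j=1}^N p_{ij} = 1$ for every $i$. A row vector $\nu = (\nu_1,\dotsc,\nu_N)$ is an invariant probability for $P$ if $\nu_i \ge 0$ for all $i$, $\sum_i \nu_i = 1$ and $\nu = \nu P$. The deterministic joint spectral radius is $$\rho_{\mathrm d}(\mathcal A) = \limsup_{n\to\infty} \max_{(i_1,\dotsc,i_n)\in\{1,\dotsc,N\}^n} \|A_{i_n}\dotsm A_{i_1}\|^{1/n}.$$ For a stochastic $P\in\mathcal M_N(\mathbb R)$ and an invariant probability $\nu$ for $P$, $$\rho_{\mathrm p}(\nu,P,\mathcal A) = \limsup_{n\to\infty} \sum_{(i_1,\dotsc,i_n)\in\{1,\dotsc,N\}^n} \nu_{i_1} p_{i_1 i_2}\dotsm p_{i_{n-1}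 i_n} \|A_{i_n}\dotsm A_{i_1}\|^{1/n},$$ and $$\rho_{\mathrm p}(\mathcal A) = \sup_{(\nu,P)} \rho_{\mathrm p}(\nu,P,\mathcal A),$$ the supremum being over all pairs $(\nu,P)$ with $P$ an $N\times N$ stochastic matrix and $\nu$ an invariant probability for $P$. *)

(* Defs.v *)
From HB Require Import structures.
From mathcomp Require Import all_boot all_order all_algebra.
From mathcomp Require Import complex.
From mathcomp Require Import all_classical all_reals all_analysis.

Set Implicit Arguments.
Unset Strict Implicit.
Unset Printing Implicit Defensive.

Import Order.TTheory GRing.Theory Num.Theory.
Import numFieldNormedType.Exports.

Local Open Scope classical_set_scope.
Local Open Scope ring_scope.

Section Norms.
Context {R : realType} {d : nat}.

Definition is_vector_norm (nrm : 'cV[R]_d -> R) : Prop :=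
  [/\ forall x, 0 <= nrm x,
      forall x, nrm x = 0 -> x = 0,
      forall (a : R) x, nrm (a *: x) = `|a| * nrm x &
      forall x y, nrm (x + y) <= nrm x + nrm y].

Definition induced_norm (nrm : 'cV[R]_d -> R) (M : 'M[R]_d) : R :=
  sup [set nrm (M *m x) | x in [set x | nrm x <= 1]].

(* [eigenvalue] is about left eigenvectors over the field of the entries, so
   the real matrix is first mapped into the complex numbers [R[i]]. *)
Definition spectral_radius (M : 'M[R]_d) : R :=
  sup [set ComplexField.Normc.normc z
      | z in [set z : R[i] | eigenvalue (map_mx (real_complex R) M) z]].

End Norms.

Section JointSpectralRadii.
Context {R : realType} {d N : nat}.

Definition stochastic (P : 'M[R]_N) : Prop :=
  (forall i j, 0 <= P i j) /\ (forall i, \sum_j P i j = 1).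

Definition invariant_probability (P : 'M[R]_N) (nu : 'rV[R]_N) : Prop :=
  [/\ forall i, 0 <= nu 0 i, \sum_i nu 0 i = 1 & nu = nu *m P].

(* For [w = (i_1, ..., i_n)], the reversed product [A_{i_n} ... A_{i_1}]. *)
Definition word_prod (A : 'I_N -> 'M[R]_d) (w : seq 'I_N) : 'M[R]_d :=
  \big[mulmx/1%:M]_(i <- rev w) A i.

(* The pairs of [zip w (behead w)] are the consecutive letters of [w]. *)
Definition word_weight (nu : 'rV[R]_N) (P : 'M[R]_N) (n : nat)
    (w : n.+1.-tuple 'I_N) : R :=
  nu 0 (thead w) * \prod_(e <- zip w (behead w)) P e.1 e.2.

(* Words are nonempty: the term of index [n] of the sequences below is about
   words of length [n.+1], which does not change the limit superior. *)
Definition rho_d (nrm : 'cV[R]_d -> R) (A : 'I_N -> 'M[R]_d) : \bar R :=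
  limn_esup (fun n : nat =>
    (\big[Num.max/0]_(w : n.+1.-tuple 'I_N)
        induced_norm nrm (word_prod A w) `^ (n.+1%:R^-1))%:E).

Definition rho_p_markov (nrm : 'cV[R]_d -> R) (nu : 'rV[R]_N) (P : 'M[R]_N)
    (A : 'I_N -> 'M[R]_d) : \bar R :=
  limn_esup (fun n : nat =>
    (\sum_(w : n.+1.-tuple 'I_N)
        word_weight nu P w *
        induced_norm nrm (word_prod A w) `^ (n.+1%:R^-1))%:E).

Definition rho_p (nrm : 'cV[R]_d -> R) (A : 'I_N -> 'M[R]_d) : \bar R :=
  ereal_sup [set rho_p_markov nrm x.1 x.2 A
            | x in [set x : 'rV[R]_N * 'M[R]_N
                   | stochastic x.2 /\ invariant_probability x.2 x.1]].

End JointSpectralRadii.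

(* Main.v *)
(** The Markov chain that runs around a cycle [w] of distinct
    letters shows that [rho(A_w)^(1/k) <= rho_p <= rho_d], so (b) implies (a).

    Conversely, suppose that every such cycle has [rho(A_w)^(1/k) < rho_d] and
    normalise so that [rho_d = 1].  For each small [delta] there is a norm [p]
    in which all words of a suitable length [T] have norm at most [1 + delta],
    while the words of length [T] that repeat a simple cycle have norm at most
    [1/2 + delta].  When the semigroup of products is bounded, [p x] is the
    supremum of the norms over the orbit of [x].  Otherwise the vectors with
    bounded orbits form an invariant subspace, which is proper, and nonzero by
    compactness of the sphere; one glues norms on it and on the quotient.

    Following from a state of mass at least [1/N] the most likely transitions,
    of probability at least [1/N], leads to a simple cycle.  Hence every
    stationary chain gives mass at least some [c > 0], depending on [N] and
    [T] only, to one of the contracted words.  So the mean of [||A_w||^(1/T)]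
    over the words of length [T] is less than 1, uniformly in the chain.  By
    weighted AM-GM, [n] times the mean of [||A_w||^(1/n)] over the words of
    length [n] is subadditive in [n], whence this mean at length [T] bounds
    [rho_p(nu, P, A)], and [rho_p < 1]. *)

Require Import Defs.
From mathcomp Require Import all_boot all_order all_algebra.
From mathcomp Require Import complex.
From mathcomp Require Import all_classical all_reals all_analysis.
From mathcomp Require Import ring lra.

Set Implicit Arguments.
Unset Strict Implicit.
Unset Printing Implicit Defensive.

Import Order.TTheory GRing.Theory Num.Theory.
Import numFieldNormedType.Exports.

Local Open Scope classical_set_scope.
Local Open Scope ring_scope.

(** * Norms on finite-dimensional spaces *)

Section MatrixNorm.
Context {R : realType}.
Implicit Types m n p : nat.

(* The entrywise l1 norm is submultiplicative in all dimensions, including 0. *)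
Definition mnorm m n (M : 'M[R]_(m, n)) : R := \sum_i \sum_j `|M i j|.

Lemma mnorm_ge0 m n (M : 'M[R]_(m, n)) : 0 <= mnorm M.
Proof. by apply: sumr_ge0 => i _; apply: sumr_ge0. Qed.

Lemma mnorm_entry m n (M : 'M[R]_(m, n)) i j : `|M i j| <= mnorm M.
Proof.
rewrite /mnorm (bigD1 i)//= (bigD1 j)//= -addrA lerDl addr_ge0//.
  by apply: sumr_ge0.
by apply: sumr_ge0 => k _; apply: sumr_ge0.
Qed.

Lemma mnorm_eq0 m n (M : 'M[R]_(m, n)) : mnorm M = 0 -> M = 0.
Proof.
move=> M0; apply/matrixP => i j; rewrite mxE; apply/eqP.
by rewrite -normr_le0 -M0 mnorm_entry.
Qed.

Lemma mnorm0 m n : mnorm (0 : 'M[R]_(m, n)) = 0.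
Proof. by rewrite /mnorm big1// => i _; rewrite big1// => j _; rewrite mxE normr0. Qed.

Lemma mnormD m n (M M' : 'M[R]_(m, n)) : mnorm (M + M') <= mnorm M + mnorm M'.
Proof.
rewrite /mnorm -big_split ler_sum//= => i _.
by rewrite -big_split ler_sum//= => j _; rewrite mxE ler_normD.
Qed.

Lemma mnormZ m n (a : R) (M : 'M[R]_(m, n)) : mnorm (a *: M) = `|a| * mnorm M.
Proof.
rewrite /mnorm mulr_sumr; apply: eq_bigr => i _; rewrite mulr_sumr.
by apply: eq_bigr => j _; rewrite mxE normrM.
Qed.

Lemma mnormB m n (M M' : 'M[R]_(m, n)) : mnorm (M - M') = mnorm (M' - M).
Proof. by rewrite -opprB -scaleN1r mnormZ normrN1 mul1r. Qed.

Lemma mnormM m n p (M : 'M[R]_(m, n)) (M' : 'M[R]_(n, p)) :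
  mnorm (M *m M') <= mnorm M * mnorm M'.
Proof.
rewrite /mnorm mulr_suml ler_sum// => i _; rewrite mulr_suml.
apply: (@le_trans _ _ (\sum_j \sum_k `|M i k| * `|M' k j|)).
  apply: ler_sum => j _; rewrite mxE; apply: le_trans (ler_norm_sum _ _ _) _.
  by apply: ler_sum => k _; rewrite normrM.
rewrite exchange_big ler_sum//= => k _; rewrite -mulr_sumr ler_wpM2l//.
by rewrite (bigD1 k)//= lerDl; apply: sumr_ge0 => l _; apply: sumr_ge0.
Qed.

Lemma mnorm_tr m n (M : 'M[R]_(m, n)) : mnorm M^T = mnorm M.
Proof.
by rewrite /mnorm exchange_big; do 2 (apply: eq_bigr => ? _); rewrite mxE.
Qed.

(** The unit sphere lies in the cube with sides [[-1, 1]], which is compact. The transposes are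
    there because [rV_compact] is about row vectors. *)
Lemma unit_sphere_cluster n (u : nat -> 'cV[R]_n) :
  (forall k, mnorm (u k) = 1) ->
  exists2 x, mnorm x = 1 &
    forall e k0, 0 < e -> exists2 k, (k0 <= k)%N & mnorm (u k - x) < e.
Proof.
move=> u1.
have Kc : compact [set v : 'rV[R]_n | forall i, v ord0 i \in `[(-1 : R), 1]].
  apply: (@rV_compact _ _ (fun=> `[(-1 : R), 1]%classic)) => _.
  exact: segment_compact.
pose F := (fun k => (u k)^T) @ \oo.
have FK : F [set v : 'rV[R]_n | forall i, v ord0 i \in `[(-1 : R), 1]].
  exists 0%N => // k _ /= i.
  have : `|(u k)^T ord0 i| <= 1.
    by rewrite -(u1 k) -mnorm_tr mnorm_entry.
  by rewrite ler_norml in_itv.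
have [x [_ xF]] := Kc F _ FK.
have clus e k0 : 0 < e -> exists2 k, (k0 <= k)%N & mnorm (u k - x^T) < e.
  (* The ball is that of the sup norm, while [mnorm] adds up [n] entries; [n.+1] also covers
     [n = 0]. *)
  move=> e0; pose e' := e / n.+1%:R.
  have e'0 : 0 < e' by rewrite divr_gt0.
  have Fk0 : F [set v | exists2 k, (k0 <= k)%N & v = (u k)^T].
    by exists k0 => // k /= k0k; exists k.
  have [v [[k k0k ->]]] := xF _ _ Fk0 (nbhsx_ballx x e' e'0).
  rewrite mx_norm_ball /ball_/= => xv; exists k => //.
  rewrite mnormB -mnorm_tr linearB/= trmxK /mnorm big_ord1.
  apply: (@le_lt_trans _ _ (\sum_(j < n) e')).
    apply: ler_sum => j _; apply/ltW; apply: le_lt_trans xv.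
    rewrite [leRHS]/Num.norm/= mx_normrE.
    by apply: (le_bigmax _ (fun ij : 'I_1 * 'I_n => `|(x - (u k)^T) ij.1 ij.2|) (ord0, j)).
  rewrite sumr_const card_ord -mulr_natr mulrAC.
  by rewrite ltr_pdivrMr// ltr_pM2l// ltr_nat.
exists x^T; last exact: clus.
apply/eqP; rewrite -subr_eq0 -normr_le0; apply/ler_addgt0Pr => e e0.
rewrite add0r; have [k _ /ltW ke] := clus e 0%N e0.
apply: le_trans ke; rewrite -(u1 k) ler_norml.
have := mnormD (u k - x^T) x^T; have := mnormD (x^T - u k) (u k).
by rewrite !subrK (mnormB x^T); lra.
Qed.

End MatrixNorm.

Section VectorNorms.
Context {R : realType} {d : nat} (p : 'cV[R]_d -> R).
Hypothesis pP : is_vector_norm p.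

Lemma vnorm_ge0 x : 0 <= p x. Proof. by case: pP. Qed.
Lemma vnorm_eq0 x : p x = 0 -> x = 0. Proof. by case: pP => _ + _ _; apply. Qed.
Lemma vnormZ a x : p (a *: x) = `|a| * p x. Proof. by case: pP. Qed.
Lemma vnormD x y : p (x + y) <= p x + p y. Proof. by case: pP. Qed.
Lemma vnorm0 : p 0 = 0. Proof. by rewrite -(scale0r 0) vnormZ normr0 mul0r. Qed.
Lemma vnormB x y : p (x - y) = p (y - x).
Proof. by rewrite -opprB -scaleN1r vnormZ normrN1 mul1r. Qed.

Lemma vnorm_sum I (r : seq I) (f : I -> 'cV[R]_d) :
  p (\sum_(i <- r) f i) <= \sum_(i <- r) p (f i).
Proof.
elim: r => [|i r IH]; first by rewrite !big_nil vnorm0.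
by rewrite !big_cons (le_trans (vnormD _ _))// lerD2l.
Qed.

Lemma vnorm_le_mnorm : exists2 C, 0 < C & forall x, p x <= C * mnorm x.
Proof.
exists (1 + \sum_i p (delta_mx i 0)).
  by rewrite ltr_wpDr// sumr_ge0// => i _; exact: vnorm_ge0.
move=> x; rewrite {1}[x]matrix_sum_delta; under eq_bigr do rewrite big_ord1.
apply: le_trans (vnorm_sum _ _) _.
apply: (@le_trans _ _ ((\sum_i p (delta_mx i 0)) * mnorm x)).
  rewrite mulr_suml ler_sum// => i _; rewrite vnormZ mulrC ler_wpM2l//.
    exact: vnorm_ge0.
  exact: mnorm_entry.
by rewrite ler_wpM2r ?mnorm_ge0// lerDr.
Qed.

(** The compactness half of the equivalence of norms: otherwise unit vectors with [p] tending to 0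
    would cluster at a unit vector on which [p] vanishes. *)
Lemma mnorm_le_vnorm : exists2 C, 0 < C & forall x, mnorm x <= C * p x.
Proof.
have [C C0 pC] := vnorm_le_mnorm.
apply: contrapT => nC.
have small k : exists x, mnorm x = 1 /\ p x < k.+1%:R^-1.
  apply: contrapT => nk; apply: nC; exists k.+1%:R => // x.
  have [x0|x0] := eqVneq (mnorm x) 0.
    by rewrite x0 mulr_ge0// vnorm_ge0.
  have xgt0 : 0 < mnorm x by rewrite lt_def x0 mnorm_ge0.
  rewrite leNgt; apply/negP => lt; apply: nk.
  exists ((mnorm x)^-1 *: x); rewrite mnormZ vnormZ ger0_norm ?invr_ge0 ?mnorm_ge0//.
  split; first by rewrite mulVf.
  by rewrite mulrC ltr_pdivrMr// mulrC ltr_pdivlMr// mulrC.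
have [u uP] := choice small.
have [x x1 ux] := unit_sphere_cluster (fun k => (uP k).1).
suff px : p x = 0 by move: x1; rewrite (vnorm_eq0 px) mnorm0 => /esym/eqP; rewrite oner_eq0.
apply/eqP; rewrite eq_le vnorm_ge0 andbT; apply/ler_addgt0Pr => e e0.
have [k ke uk] := ux (e / 2 / C) (Num.truncn (2 / e)).+1 ltac:(by rewrite !divr_gt0).
have pk : p (u k) <= e / 2.
  rewrite (le_trans (ltW (uP k).2))// -[leRHS]invrK lef_pV2 ?posrE ?invr_gt0 ?divr_gt0//.
  rewrite invf_div (le_trans (ltW (truncnS_gt _)))//.
  by rewrite ler_nat (leq_trans ke).
have := vnormD (x - u k) (u k); rewrite subrK add0r => /le_trans; apply.
have pd : p (x - u k) <= e / 2.
  rewrite vnormB (le_trans (pC _))// mulrC -ler_pdivlMr//; exact: ltW.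
lra.
Qed.

End VectorNorms.

(** * Geometric sequences and roots *)

Section GeometricSequences.
Context {R : realType}.

Lemma expr_eventually_lt (q c : R) : 0 <= q < 1 -> 0 < c ->
  exists n0, forall n, (n0 <= n)%N -> q ^+ n < c.
Proof.
move=> /andP[q0 q1] c0.
have /cvgrPdist_lt/(_ c c0) [n0 _ H] : GRing.exp q @ \oo --> (0 : R).
  by apply: cvg_expr; rewrite ger0_norm.
exists n0 => n /H; rewrite sub0r normrN ger0_norm//; exact: exprn_ge0.
Qed.

Lemma expr_unbounded (q K : R) : 1 < q -> exists n, K < q ^+ n.
Proof.
move=> q1; have q0 : 0 < q by apply: lt_trans q1.
have [||n0 /(_ n0 (leqnn _))] := @expr_eventually_lt q^-1 (`|K| + 1)^-1.
- by rewrite invr_ge0 ltW//= invf_lt1.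
- by rewrite invr_gt0 ltr_wpDl.
rewrite exprVn ltf_pV2 ?posrE ?exprn_gt0 ?ltr_wpDl// => H.
by exists n0; apply: le_lt_trans H; have := ler_norm K; lra.
Qed.

Lemma root_gt1 (c : R) n : 1 < c -> exists2 s, 1 < s & s ^+ n.+1 = c.
Proof.
move=> c1; have c0 : 0 <= c by rewrite ltW// (lt_trans _ c1).
exists (c `^ n.+1%:R^-1).
  have {1}-> : 1 = 1 `^ n.+1%:R^-1 :> R by rewrite powR1.
  by rewrite gt0_ltr_powR ?invr_gt0 ?nnegrE.
by rewrite -powR_mulrn ?powR_ge0// -powRrM mulVf// powRr1.
Qed.

End GeometricSequences.

(** * Products along words *)

Section WordProducts.
Context {R : realType} {d N : nat}.
Implicit Types (A : 'I_N -> 'M[R]_d) (u v w : seq 'I_N) (i : 'I_N).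

Lemma word_prod_nil A : word_prod A [::] = 1%:M.
Proof. by rewrite /word_prod big_nil. Qed.

Lemma word_prod_cat A u v : word_prod A (u ++ v) = word_prod A v *m word_prod A u.
Proof.
rewrite /word_prod rev_cat; elim: (rev v) => [|i r IH].
  by rewrite big_nil mul1mx.
by rewrite cat_cons !big_cons IH mulmxA.
Qed.

Lemma word_prod1 A i : word_prod A [:: i] = A i.
Proof. by rewrite /word_prod big_cons big_nil mulmx1. Qed.

Lemma word_prod_cons A i w : word_prod A (i :: w) = word_prod A w *m A i.
Proof. by rewrite -cat1s word_prod_cat word_prod1. Qed.

Lemma word_prodZ A (c : R) w :
  word_prod (fun i => c *: A i) w = c ^+ size w *: word_prod A w.
Proof.
elim: w => [|i w IH]; first by rewrite !word_prod_nil expr0 scale1r.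
by rewrite !word_prod_cons IH /= -scalemxAl -scalemxAr scalerA -exprSr.
Qed.

Definition word_pow w m : seq 'I_N := flatten (nseq m w).

Lemma word_powS w m : word_pow w m.+1 = w ++ word_pow w m.
Proof. by []. Qed.

Lemma size_word_pow w m : size (word_pow w m) = (m * size w)%N.
Proof. by elim: m => // m IH; rewrite word_powS size_cat IH mulSn. Qed.

Lemma word_powD w m n : word_pow w (m + n) = word_pow w m ++ word_pow w n.
Proof. by rewrite /word_pow nseqD flatten_cat. Qed.

Lemma word_powM w m n : word_pow w (n * m) = word_pow (word_pow w m) n.
Proof. by elim: n => // n IH; rewrite mulSn word_powD IH. Qed.

Lemma word_prod_pow A w m : word_prod A (word_pow w m) = word_prod A w ^+ m.
Proof.
elim: m => [|m IH]; first by rewrite word_prod_nil expr0.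
by rewrite word_powS word_prod_cat IH exprSr.
Qed.

(** Expresses that the joint spectral radius is at most 1, in a form that passes to subspaces and
    quotients. *)
Definition subexponential A : Prop := forall s : R, 1 < s ->
  exists K : R, forall w, mnorm (word_prod A w) <= K * s ^+ size w.

Definition decaying (Ws : set (seq 'I_N)) A : Prop :=
  exists K s : R, 0 <= s < 1 /\
    forall w m, Ws w -> mnorm (word_prod A (word_pow w m)) <= K * s ^+ m.

Definition bounded_orbit A (x : 'cV[R]_d) : Prop :=
  exists K : R, forall w, mnorm (word_prod A w *m x) <= K.

(** If no length sufficed, unit vectors that words of length up to [k] do not expand beyond 2 would
    cluster, as [k] grows, at a unit vector whose whole orbit is bounded by 2. *)
Lemma mnorm_bounded_expansion A : (forall x, bounded_orbit A x -> x = 0) ->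
  exists L, forall x : 'cV[R]_d, exists2 w, (size w <= L)%N &
    2 * mnorm x <= mnorm (word_prod A w *m x).
Proof.
move=> nb.
have [L HL] : exists L, forall x : 'cV[R]_d, mnorm x = 1 -> exists2 w, (size w <= L)%N &
    2 < mnorm (word_prod A w *m x).
  apply: contrapT => nL.
  have small k : exists x : 'cV[R]_d, mnorm x = 1 /\ forall w, (size w <= k)%N ->
      mnorm (word_prod A w *m x) <= 2.
    apply: contrapT => nk; apply: nL; exists k => x x1; apply: contrapT => nx.
    apply: nk; exists x; split=> // w wk; rewrite leNgt; apply/negP => w2.
    by apply: nx; exists w.
  have [u uP] := choice small.
  have [x x1 ux] := unit_sphere_cluster (fun k => (uP k).1).
  suff x0 : x = 0 by move: x1; rewrite x0 mnorm0 => /esym/eqP; rewrite oner_eq0.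
  apply: nb; exists 2 => w; apply/ler_addgt0Pr => e e0.
  have M0 := mnorm_ge0 (word_prod A w).
  have M1 : 0 < mnorm (word_prod A w) + 1 by rewrite ltr_wpDl.
  have [k wk uk] := ux (e / (mnorm (word_prod A w) + 1)) (size w) (divr_gt0 e0 M1).
  rewrite -[x](subrK (u k)) mulmxDr (le_trans (mnormD _ _))// addrC lerD//.
    exact: (uP k).2.
  rewrite (le_trans (mnormM _ _))// mnormB.
  apply: (@le_trans _ _ ((mnorm (word_prod A w) + 1) * mnorm (u k - x))).
    by rewrite ler_wpM2r ?mnorm_ge0// lerDl.
  by rewrite mulrC -ler_pdivlMr// ltW.
exists L => x; have [x0|x0] := eqVneq (mnorm x) 0.
  by exists [::] => //; rewrite x0 mulr0 mnorm_ge0.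
have xgt0 : 0 < mnorm x by rewrite lt_def x0 mnorm_ge0.
have [|w wL] := HL ((mnorm x)^-1 *: x).
  by rewrite mnormZ gtr0_norm ?invr_gt0// mulVf.
rewrite -scalemxAr mnormZ gtr0_norm ?invr_gt0// mulrC ltr_pdivlMr// => /ltW.
by exists w.
Qed.

(** Otherwise every vector is doubled by some word of length at most [L]; iterating this produces
    exponential growth. *)
Lemma exists_bounded_orbit A : subexponential A -> (0 < d)%N ->
  exists2 x, x != 0 & bounded_orbit A x.
Proof.
move=> Asub d0; apply: contrapT => nex.
have nb x : bounded_orbit A x -> x = 0.
  by move=> bx; apply/eqP/negPn/negP => x0; apply: nex; exists x.
have [L HL] := mnorm_bounded_expansion nb.
pose x0 : 'cV[R]_d := const_mx 1.
have x0gt : 0 < mnorm x0.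
  apply: lt_le_trans (mnorm_entry x0 (Ordinal d0) 0).
  by rewrite mxE normr1.
have grow n : exists2 w, (size w <= n * L.+1)%N &
    2 ^+ n * mnorm x0 <= mnorm (word_prod A w *m x0).
  elim: n => [|n [w wn IH]].
    by exists [::] => //; rewrite word_prod_nil mul1mx expr0 mul1r.
  have [v vL Hv] := HL (word_prod A w *m x0).
  exists (w ++ v); first by rewrite size_cat mulSn addnC leq_add// ltnW.
  rewrite word_prod_cat -mulmxA; apply: le_trans Hv.
  by rewrite exprS -mulrA ler_wpM2l.
(* Any value strictly between 1 and 2 would serve as [s ^+ L.+1]. With 3/2, products of length at
   most [n * L.+1] are bounded by [K * (3 / 2) ^+ n], and the ratio with [2 ^+ n] is
   [(4 / 3) ^+ n]. *)
have [s s1 sL] := @root_gt1 R (3 / 2) L ltac:(lra).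
have [K HK] := Asub _ s1.
have [n] := @expr_unbounded R (4 / 3) K ltac:(lra).
apply/negP; rewrite -leNgt.
have [w wn Hw] := grow n.
have K0 : 0 <= K.
  by have := HK [::]; rewrite expr0 mulr1; apply: le_trans; exact: mnorm_ge0.
have le1 : 2 ^+ n <= K * (3 / 2) ^+ n.
  rewrite -(ler_pM2r x0gt); apply: le_trans Hw _.
  apply: le_trans (mnormM _ _) _; rewrite ler_wpM2r ?mnorm_ge0//.
  apply: le_trans (HK w) _; rewrite ler_wpM2l// -sL -exprM mulnC.
  by rewrite ler_weXn2l// ltW.
have h0 : 0 < (3 / 2 : R) ^+ n by apply: exprn_gt0; lra.
rewrite -(ler_pM2r h0).
by rewrite -exprMn (_ : 4 / 3 * (3 / 2) = 2 :> R)//; field.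
Qed.

End WordProducts.

(** * Subspaces and their complements in coordinates *)

Section InvariantSubspaces.
Context {R : realType}.

(** Take [U] of maximal rank among the matrices whose row space lies in [P]; adjoining a vector of
    [P] cannot raise the rank. *)
Lemma row_space_of_subspace d (P : 'rV[R]_d -> Prop) : P 0 ->
    (forall a x y, P x -> P y -> P (a *: x + y)) ->
  exists U : 'M[R]_d, forall x, P x <-> (x <= U)%MS.
Proof.
move=> P0 Plin.
pose good n := `[< exists U : 'M[R]_d,
  \rank U = n /\ forall x, (x <= U)%MS -> P x >].
have ex_good : exists n, good n.
  exists 0%N; apply/asboolP; exists 0; split; first exact: mxrank0.
  by move=> x; rewrite submx0 => /eqP ->.
have le_good n : good n -> (n <= d)%N.
  by move=> /asboolP [U [<- _]]; exact: rank_leq_row.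
case: (ex_maxnP ex_good le_good) => n /asboolP [U [rU UP]] nmax.
exists U => x; split=> [Px|]; last exact: UP.
have : good (\rank (U + x)%MS).
  apply/asboolP; exists (U + x)%MS; split=> // y /sub_addsmxP [[u v] /= ->].
  rewrite [v]mx11_scalar mul_scalar_mx addrC; apply: Plin => //.
  by apply: UP; rewrite submxMl.
move=> /nmax; rewrite -rU => rle.
have /mxrank_leqif_sup/geq_leqif H : (U <= U + x)%MS by rewrite addsmxSl.
by move: rle; rewrite H => Ux; apply: submx_trans Ux; rewrite addsmxSr.
Qed.

(* [E] embeds the subspace, [F] is the quotient map, and [E'], [F'] are the
   projection and the section given by a complement. *)
Lemma subspace_splitting d (V : 'cV[R]_d -> Prop) : V 0 ->
    (forall a x y, V x -> V y -> V (a *: x + y)) ->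
    (exists2 x, x != 0 & V x) -> (exists x, ~ V x) ->
  exists m n, exists (E : 'M[R]_(d, m)) (E' : 'M[R]_(m, d)) (F : 'M[R]_(n, d))
    (F' : 'M[R]_(d, n)),
    [/\ (m < d)%N /\ (n < d)%N, E' *m E = 1%:M /\ F *m F' = 1%:M,
        E *m E' + F' *m F = 1%:M,
        forall y, V (E *m y) & forall x, V x -> F *m x = 0].
Proof.
move=> V0 Vlin [x0 x00 Vx0] [x1 nVx1].
have [||U UP] := @row_space_of_subspace d (fun x => V x^T).
- by rewrite trmx0.
- by move=> a x y Vx Vy; rewrite linearP; apply: Vlin.
(* Bases of the subspace and of a complement are stacked into an invertible [Z]. The blocks of
   [Z *m Y = 1] and [Y *m Z = 1] give, after transposition, all the required relations. *)
pose e := row_base U; pose f := row_base (U^C)%MS.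
pose Z := col_mx e f; pose Y := pinvmx Z.
have Zsum : (Z :=: U + U^C)%MS.
  apply: eqmx_trans (eqmx_sym (addsmxE _ _)) _.
  by apply: adds_eqmx; exact: eq_row_base.
have rZ : \rank Z = (\rank U + \rank (U^C)%MS)%N.
  rewrite Zsum mxrank_disjoint_sum//; exact: capmx_compl.
have rU : (\rank U + \rank (U^C)%MS)%N = d.
  by rewrite mxrank_compl subnKC// rank_leq_row.
have YZ : Y *m Z = 1%:M.
  have /mulmxKpV : (1%:M <= Z)%MS by rewrite submx_full// /row_full Zsum; exact: addsmx_compl_full.
  by rewrite mul1mx.
have ZY : Z *m Y = 1%:M by apply: mulmxVp; rewrite /row_free rZ.
move: ZY; rewrite -(hsubmxK Y) mul_col_row scalar_mx_block.
move=> /eq_block_mx [ee' ef' fe' ff'].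
have Ugt0 : (0 < \rank U)%N.
  rewrite lt0n mxrank_eq0; apply: contra_neq x00 => U0.
  have : (x0^T <= U)%MS by apply/UP; rewrite trmxK.
  by rewrite U0 submx0 => /eqP/(congr1 trmx); rewrite trmxK trmx0.
have Ultd : (\rank U < d)%N.
  rewrite ltn_neqAle rank_leq_row andbT; apply/negP => fullU; apply: nVx1.
  by rewrite -[x1]trmxK; apply/UP; rewrite submx_full// /row_full.
exists (\rank U), (\rank (U^C)%MS), e^T, (lsubmx Y)^T, (rsubmx Y)^T, f^T.
split.
- by split=> //; rewrite mxrank_compl ltn_subrL Ugt0 (leq_trans _ Ultd).
- by rewrite -!trmx_mul ee' ff' !trmx1.
- by rewrite -!trmx_mul -linearD /= -mul_row_col hsubmxK YZ trmx1.
- move=> y; rewrite -[X in V X]trmxK; apply/UP; rewrite trmx_mul trmxK.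
  by apply: submx_trans (submxMl _ _) _; rewrite eq_row_base.
- move=> x Vx; rewrite -[x]trmxK -trmx_mul.
  have : (x^T <= e)%MS by rewrite eq_row_base; apply/UP; rewrite trmxK.
  by move=> /submxP [D ->]; rewrite -mulmxA ef' mulmx0 trmx0.
Qed.

End InvariantSubspaces.

(** * Adapted norms *)

Section AdaptedNorms.
Context {R : realType} {N : nat}.

(** The norm is the supremum over the orbit: the orbit of [word_prod A w *m x] is part of that of
    [x], and the empty word gives the lower bound by [mnorm]. *)
Lemma bounded_adapted_norm d (A : 'I_N -> 'M[R]_d) (K : R) :
    (forall w, mnorm (word_prod A w) <= K) ->
  exists p : 'cV[R]_d -> R, [/\ is_vector_norm p,
    forall w x, p (word_prod A w *m x) <= p x,
    forall x, mnorm x <= p x & forall x, p x <= K * mnorm x].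
Proof.
move=> AK; pose S (x : 'cV[R]_d) := [set mnorm (word_prod A w *m x) | w in setT].
pose p x := sup (S x).
have upK (x : 'cV[R]_d) w : mnorm (word_prod A w *m x) <= K * mnorm x.
  by rewrite (le_trans (mnormM _ _))// ler_wpM2r ?mnorm_ge0.
have S0 x : S x !=set0 by exists (mnorm (word_prod A [::] *m x)); exists [::].
have hsS x : has_sup (S x).
  by split=> //; exists (K * mnorm x) => _ [w _ <-].
have Sp x w : mnorm (word_prod A w *m x) <= p x.
  by apply: ub_le_sup; [exact: (hsS x).2 | exists w].
have pS x c : (forall w, mnorm (word_prod A w *m x) <= c) -> p x <= c.
  by move=> H; apply: ge_sup => // _ [w _ <-].
have lep x : mnorm x <= p x by have := Sp x [::]; rewrite word_prod_nil mul1mx.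
exists p; split=> //.
- split.
  + by move=> x; apply: le_trans (lep x); exact: mnorm_ge0.
  + move=> x px; apply: mnorm_eq0; apply/eqP.
    by rewrite eq_le mnorm_ge0 andbT -px lep.
  + have le1 a x : p (a *: x) <= `|a| * p x.
      by apply: pS => w; rewrite -scalemxAr mnormZ ler_wpM2l.
    (* The reverse inequality is [le1] for the inverse scalar. *)
    move=> a x; apply/eqP; rewrite eq_le le1 /=.
    have [->|a0] := eqVneq a 0.
      by rewrite normr0 mul0r scale0r; apply: le_trans (lep _); exact: mnorm_ge0.
    rewrite -ler_pdivlMl ?normr_gt0// -normfV.
    by rewrite -[in leLHS](scalerK a0 x) le1.
  + move=> x y; apply: pS => w; rewrite mulmxDr (le_trans (mnormD _ _))//.
    by rewrite lerD.
- by move=> w x; apply: pS => v; rewrite mulmxA -word_prod_cat.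
- by move=> x; apply: pS.
Qed.

(** The norm may depend on [m], [T] and [delta], so that gluing can tune its weight to them; the
    slack [delta] is what gluing consumes. The threshold [m0] comes first because [T] is later
    chosen as a multiple of [m]. *)
Definition adapted_norms (Ws : set (seq 'I_N)) d (A : 'I_N -> 'M[R]_d) : Prop :=
  exists m0, forall m T (delta : R), (m0 <= m)%N -> 0 < delta ->
    exists p : 'cV[R]_d -> R, [/\ is_vector_norm p,
      forall w x, size w = T -> p (word_prod A w *m x) <= (1 + delta) * p x &
      forall w x, Ws w ->
        p (word_prod A (word_pow w m) *m x) <= (1 / 2 + delta) * p x].

Lemma adapted_norms_bounded Ws d (A : 'I_N -> 'M[R]_d) (K : R) :
    (forall w, mnorm (word_prod A w) <= K) -> decaying Ws A ->
  adapted_norms Ws A.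
Proof.
move=> AK [K1 [s [s01 Adec]]].
have [p [pP pA lep pK]] := bounded_adapted_norm AK.
have K0 : 0 <= K by apply: le_trans (AK [::]); exact: mnorm_ge0.
pose c := K * `|K1| + 1.
have c0 : 0 < c by rewrite ltr_wpDl// mulr_ge0.
have [m0 Hm0] := @expr_eventually_lt R s (1 / 2 / c) s01 ltac:(by rewrite !divr_gt0).
exists m0 => m T delta m0m delta0; exists p; split=> // w x.
  by move=> _; rewrite (le_trans (pA _ _))// ler_peMl ?(vnorm_ge0 pP)// lerDl ltW.
move=> Ww; rewrite (le_trans (pK _))//.
have sm : K * K1 * s ^+ m <= 1 / 2 + delta.
  have s0 : 0 <= s by case/andP: s01.
  apply: (@le_trans _ _ (c * s ^+ m)).
    rewrite ler_wpM2r ?exprn_ge0// /c (@le_trans _ _ (K * `|K1|)) ?lerDl//.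
    by rewrite ler_wpM2l// ler_norm.
  rewrite mulrC -ler_pdivlMr//; apply: (le_trans (ltW (Hm0 _ m0m))).
  by rewrite ler_wpM2r ?invr_ge0 ?ltW// ltrDl.
apply: (@le_trans _ _ (K * (K1 * s ^+ m * mnorm x))).
  rewrite ler_wpM2l// (le_trans (mnormM _ _))// ler_wpM2r ?mnorm_ge0//.
  exact: Adec.
rewrite !mulrA; apply: (le_trans (ler_wpM2r (mnorm_ge0 x) sm)).
by rewrite ler_wpM2l// addr_ge0 ?divr_ge0// ltW.
Qed.

(** * Gluing norms on an invariant subspace and on its quotient *)

Section Splitting.
Variables (Ws : set (seq 'I_N)) (d m n : nat) (A : 'I_N -> 'M[R]_d).
Variables (E : 'M[R]_(d, m)) (E' : 'M[R]_(m, d)) (F : 'M[R]_(n, d))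
  (F' : 'M[R]_(d, n)).
Hypotheses (E'E : E' *m E = 1%:M) (FF' : F *m F' = 1%:M)
  (EF : E *m E' + F' *m F = 1%:M) (FAE : forall i, F *m A i *m E = 0).

(** [B] is the restriction to the subspace and [C] the action on the quotient; [FAE] expresses
    invariance. *)
Let B i := E' *m A i *m E.
Let C i := F *m A i *m F'.

Lemma word_prod_sub w : word_prod A w *m E = E *m word_prod B w.
Proof.
have AE i : A i *m E = E *m B i.
  rewrite /B !mulmxA -[LHS]mul1mx -EF mulmxDl -!mulmxA [F *m (_ *m _)]mulmxA.
  by rewrite FAE mulmx0 addr0.
elim: w => [|i w IH]; first by rewrite !word_prod_nil mul1mx mulmx1.
by rewrite !word_prod_cons -mulmxA AE mulmxA IH mulmxA.
Qed.

Lemma word_prod_quo w : F *m word_prod A w = word_prod C w *m F.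
Proof.
have FA i : F *m A i = C i *m F.
  rewrite /C -[LHS]mulmx1 -EF mulmxDr [_ *m (E *m _)]mulmxA FAE mul0mx add0r.
  by rewrite !mulmxA.
elim: w => [|i w IH]; first by rewrite !word_prod_nil mul1mx mulmx1.
by rewrite !word_prod_cons mulmxA IH -mulmxA FA mulmxA.
Qed.

Lemma mnorm_word_prod_sub w :
  mnorm (word_prod B w) <= mnorm E' * mnorm E * mnorm (word_prod A w).
Proof.
rewrite -[word_prod B w]mul1mx -E'E -mulmxA -word_prod_sub mulrAC mulmxA.
rewrite (le_trans (mnormM _ _))// ler_wpM2r ?mnorm_ge0//; exact: mnormM.
Qed.

Lemma mnorm_word_prod_quo w :
  mnorm (word_prod C w) <= mnorm F * mnorm F' * mnorm (word_prod A w).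
Proof.
rewrite -[word_prod C w]mulmx1 -FF' mulmxA -word_prod_quo mulrAC.
rewrite (le_trans (mnormM _ _))// ler_wpM2r ?mnorm_ge0//; exact: mnormM.
Qed.

Lemma subexponential_splitting : subexponential A ->
  subexponential B /\ subexponential C.
Proof.
move=> Asub; split=> s s1; have [K HK] := Asub s s1.
  exists (mnorm E' * mnorm E * K) => w; rewrite (le_trans (mnorm_word_prod_sub w))//.
  by rewrite -[leRHS]mulrA ler_wpM2l ?mulr_ge0 ?mnorm_ge0.
exists (mnorm F * mnorm F' * K) => w; rewrite (le_trans (mnorm_word_prod_quo w))//.
by rewrite -[leRHS]mulrA ler_wpM2l ?mulr_ge0 ?mnorm_ge0.
Qed.

Lemma decaying_splitting : decaying Ws A -> decaying Ws B /\ decaying Ws C.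
Proof.
move=> [K [s [s01 HK]]]; split.
  exists (mnorm E' * mnorm E * K), s; split=> // w k Ww.
  rewrite (le_trans (mnorm_word_prod_sub _))//.
  by rewrite -[leRHS]mulrA ler_wpM2l ?mulr_ge0 ?mnorm_ge0// HK.
exists (mnorm F * mnorm F' * K), s; split=> // w k Ww.
rewrite (le_trans (mnorm_word_prod_quo _))//.
by rewrite -[leRHS]mulrA ler_wpM2l ?mulr_ge0 ?mnorm_ge0// HK.
Qed.

(* Weighting the quotient norm by a large [k] makes the off-diagonal block
   small. *)
Lemma adapted_norms_splitting : subexponential A -> decaying Ws A ->
  adapted_norms Ws B -> adapted_norms Ws C -> adapted_norms Ws A.
Proof.
move=> Asub Adec [mB HB] [mC HC].
exists (maxn mB mC) => l T delta; rewrite geq_max => /andP[mBl mCl] delta0.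
have delta20 : 0 < delta / 2 by rewrite divr_gt0.
have [pB [pBP pBT pBW]] := HB l T (delta / 2) mBl delta20.
have [pC [pCP pCT pCW]] := HC l T (delta / 2) mCl delta20.
(* One constant bounds all the products at stake, hence their off-diagonal blocks: those of fixed
   length [T] by subexponential growth, the powers of words of [Ws] by decay. *)
have [a a0 [aT aW]] : exists2 a : R, 0 <= a &
    (forall w, size w = T -> mnorm (word_prod A w) <= a) /\
    (forall w, Ws w -> mnorm (word_prod A (word_pow w l)) <= a).
  have [K1 HK1] := @Asub 2 ltac:(lra).
  have [K2 [s [/andP[s0 s1] HK2]]] := Adec.
  exists (`|K1 * 2 ^+ T| + `|K2|); first exact: addr_ge0.
  split=> [w wT|w Ww].
    rewrite (le_trans (HK1 w))// wT (le_trans (ler_norm _))// lerDl//.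
  rewrite (le_trans (HK2 w l Ww))// (@le_trans _ _ `|K2|)//; last by rewrite lerDr.
  rewrite (le_trans (ler_norm _))// normrM ler_piMr// ger0_norm ?exprn_ge0//.
  by rewrite exprn_ile1// ltW.
have [C1 C10 HC1] := vnorm_le_mnorm pBP.
have [C2 C20 HC2] := mnorm_le_vnorm pCP.
pose c := C1 * (mnorm E' * a * mnorm F') * C2.
have c0 : 0 <= c by rewrite !mulr_ge0 ?mnorm_ge0// ltW.
have off w (y : 'cV[R]_n) : mnorm (word_prod A w) <= a ->
    pB (E' *m word_prod A w *m F' *m y) <= c * pC y.
  move=> wa; rewrite (le_trans (HC1 _))// /c -2!(mulrA C1) ler_wpM2l ?(ltW C10)//.
  rewrite (le_trans (mnormM _ _))// -mulrA.
  rewrite ler_pM ?mnorm_ge0 ?HC2// (le_trans (mnormM _ _))//.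
  rewrite ler_wpM2r ?mnorm_ge0// (le_trans (mnormM _ _))//.
  by rewrite ler_wpM2l ?mnorm_ge0.
(* Chosen so that the off-diagonal contribution [c * pC] is at most [delta / 2] times the quotient
   term [k * pC]; the 1 keeps [k] positive when [c = 0]. *)
pose k := 2 * c / delta + 1.
have k0 : 0 < k.
  by apply: ltr_wpDl => //; apply: divr_ge0 (ltW delta0); apply: mulr_ge0.
have ck : c <= k * (delta / 2).
  have -> : k * (delta / 2) = c + delta / 2 by rewrite /k; field; rewrite gt_eqF.
  by rewrite lerDl ltW.
pose p x := pB (E' *m x) + k * pC (F *m x).
(* Used with [b = 1] and [b = 1 / 2]. The diagonal blocks spend one half of [delta], the
   off-diagonal block the other. *)
have step w x b : mnorm (word_prod A w) <= a ->
    (forall y, pB (word_prod B w *m y) <= (b + delta / 2) * pB y) ->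
    (forall y, pC (word_prod C w *m y) <= (b + delta / 2) * pC y) ->
    p (word_prod A w *m x) <= (b + delta) * p x.
  move=> wa HBw HCw; rewrite /p.
  have -> : F *m (word_prod A w *m x) = word_prod C w *m (F *m x).
    by rewrite !mulmxA word_prod_quo.
  have -> : E' *m (word_prod A w *m x) = word_prod B w *m (E' *m x)
      + E' *m word_prod A w *m F' *m (F *m x).
    rewrite -{1}[x]mul1mx -EF mulmxDl !mulmxDr; congr (_ + _).
      by rewrite !mulmxA -(mulmxA E') word_prod_sub !mulmxA E'E mul1mx.
    by rewrite !mulmxA.
  have := vnormD pBP (word_prod B w *m (E' *m x))
    (E' *m word_prod A w *m F' *m (F *m x)).
  have := off w (F *m x) wa; have := HBw (E' *m x).
  have := ler_wpM2l (ltW k0) (HCw (F *m x)).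
  have := ler_wpM2r (vnorm_ge0 pCP (F *m x)) ck.
  have := mulr_ge0 (ltW delta20) (vnorm_ge0 pBP (E' *m x)).
  by nra.
exists p; split.
- split.
  + move=> x; apply: addr_ge0 (vnorm_ge0 pBP _) _.
    exact: mulr_ge0 (ltW k0) (vnorm_ge0 pCP _).
  + move=> x /eqP; have kC0 := mulr_ge0 (ltW k0) (vnorm_ge0 pCP (F *m x)).
    rewrite (paddr_eq0 (vnorm_ge0 pBP _) kC0).
    rewrite mulf_eq0 (gt_eqF k0)/= => /andP[/eqP/(vnorm_eq0 pBP) Bx /eqP/(vnorm_eq0 pCP) Cx].
    by rewrite -[x]mul1mx -EF mulmxDl -!mulmxA Bx Cx !mulmx0 addr0.
  + by move=> b x; rewrite /p -!scalemxAr (vnormZ pBP) (vnormZ pCP); ring.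
  + move=> x y; rewrite /p !mulmxDr.
    have := vnormD pBP (E' *m x) (E' *m y).
    have := ler_wpM2l (ltW k0) (vnormD pCP (F *m x) (F *m y)); lra.
- move=> w x wT; apply: step; [exact: aT | move=> y; exact: pBT | move=> y; exact: pCT].
- by move=> w x Ww; apply: step; [exact: aW | move=> y; exact: pBW | move=> y; exact: pCW].
Qed.

End Splitting.

(* When the products are unbounded, the vectors with bounded orbits form an
   invariant subspace, proper by unboundedness and nonzero by compactness. *)
Lemma subexponential_adapted_norms Ws d (A : 'I_N -> 'M[R]_d) :
  subexponential A -> decaying Ws A -> adapted_norms Ws A.
Proof.
have [k] := ubnP d; elim: k => // k IH in d A *; rewrite ltnS => dk Asub Adec.
have [[K HK]|unb] := pselect (exists K, forall w, mnorm (word_prod A w) <= K).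
  exact: adapted_norms_bounded HK Adec.
have d0 : (0 < d)%N.
  rewrite lt0n; apply/eqP => d0; apply: unb; exists 0 => w.
  by rewrite /mnorm big1// => i; have := ltn_ord i; rewrite {2}d0.
have exV := exists_bounded_orbit Asub d0.
have exnV : exists x, ~ bounded_orbit A x.
  (* Bounded orbits of the basis vectors would bound the columns of all the products. *)
  apply: contrapT => allV; apply: unb.
  have bo i : exists K, forall w, mnorm (word_prod A w *m (delta_mx i 0 : 'cV_d)) <= K.
    by apply: contrapT => H; apply: allV; exists (delta_mx i 0).
  have [K HK] := choice bo; exists (\sum_i K i) => w.
  rewrite -mnorm_tr {1}/mnorm ler_sum// => i _.
  apply: le_trans (HK i w); rewrite -colE /mnorm ler_sum// => j _.
  by rewrite big_ord1 !mxE.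
have [||m [n [E [E' [F [F' [[md nd] [E'E FF'] EF VE FV]]]]]]] :=
    subspace_splitting _ _ exV exnV.
- by exists 0 => w; rewrite mulmx0 mnorm0.
- move=> a x y [Kx HKx] [Ky HKy]; exists (`|a| * Kx + Ky) => w.
  rewrite mulmxDr -scalemxAr (le_trans (mnormD _ _))// mnormZ lerD//.
  by rewrite ler_wpM2l.
(* Applying [A i] to a vector with bounded orbit keeps the orbit bounded, since words starting with
   [i] are among all words; [F] kills such vectors. *)
have FAE i : F *m A i *m E = 0.
  apply/trmx_inj/row_matrixP => j; rewrite trmx0 row0 -tr_col colE.
  rewrite -!mulmxA FV ?trmx0//; have [K HK] := VE (delta_mx j 0).
  by exists K => w; rewrite mulmxA -word_prod_cons.
have [Bsub Csub] := subexponential_splitting E'E FF' EF FAE Asub.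
have [Bdec Cdec] := decaying_splitting E'E FF' EF FAE Adec.
apply: (adapted_norms_splitting E'E EF FAE Asub Adec).
  exact: IH (leq_trans md dk) Bsub Bdec.
exact: IH (leq_trans nd dk) Csub Cdec.
Qed.

End AdaptedNorms.

(** * Eigenvalues and powers *)

Section SpectralRadius.
Context {R : realType}.
Local Notation normc := ComplexField.Normc.normc.

Lemma normc_ge0 (z : R[i]) : 0 <= normc z.
Proof. by case: z => a b; exact: sqrtr_ge0. Qed.

Lemma normc_real (x : R) : normc x%:C%C = `|x|.
Proof. by rewrite /normc /= expr0n addr0 sqrtr_sqr. Qed.

Lemma normc_sum I (r : seq I) (f : I -> R[i]) :
  normc (\sum_(i <- r) f i) <= \sum_(i <- r) normc (f i).
Proof.
elim: r => [|i r IH]; first by rewrite !big_nil ComplexField.Normc.normc0.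
by rewrite !big_cons (le_trans (le_normcD _ _))// lerD2l.
Qed.

Lemma normcX (z : R[i]) n : normc (z ^+ n) = normc z ^+ n.
Proof.
elim: n => [|n IH]; first by rewrite !expr0 ComplexField.Normc.normc1.
by rewrite !exprS ComplexField.Normc.normcM IH.
Qed.

Lemma map_mx_real_complexX d (M : 'M[R]_d) n :
  map_mx (real_complex R) (M ^+ n) = map_mx (real_complex R) M ^+ n.
Proof.
elim: n => [|n IH]; first by rewrite !expr0 map_mx1.
by rewrite !exprS map_mxM IH.
Qed.

(** Read [v *m M ^+ n = z ^+ n *: v] at a nonzero coordinate of the eigenvector [v]; the constant
    depends on [v] only. *)
Lemma eigenvalue_expr_le_mnorm d (M : 'M[R]_d) (z : R[i]) :
    eigenvalue (map_mx (real_complex R) M) z ->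
  exists2 c, 0 < c & forall n, c * normc z ^+ n <= mnorm (M ^+ n).
Proof.
move=> /eigenvalueP [v vM v0].
have vMn n : v *m map_mx (real_complex R) M ^+ n = z ^+ n *: v.
  elim: n => [|n IH]; first by rewrite !expr0 mulmx1 scale1r.
  by rewrite exprS mulmxA vM -scalemxAl IH scalerA -exprS.
have [j vj] : exists j, v 0 j != 0 by apply/rV0Pn.
have nvj : 0 < normc (v 0 j).
  rewrite lt_def normc_ge0 andbT; apply: contra_neq vj.
  exact: ComplexField.Normc.eq0_normc.
pose S := \sum_i normc (v 0 i).
have S0 : 0 < S.
  rewrite /S (bigD1 j)//= ltr_pwDl// sumr_ge0// => i _; exact: normc_ge0.
exists (normc (v 0 j) / S) => [|n]; first exact: divr_gt0.
rewrite mulrAC ler_pdivrMr// mulrC -normcX -ComplexField.Normc.normcM.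
have -> : z ^+ n * v 0 j = \sum_i v 0 i * ((M ^+ n) i j)%:C%C.
  transitivity ((z ^+ n *: v) 0 j); first by rewrite mxE.
  rewrite -vMn -map_mx_real_complexX mxE.
  by apply: eq_bigr => i _; rewrite mxE.
apply: le_trans (normc_sum _ _) _; rewrite /S mulr_sumr ler_sum// => i _.
rewrite ComplexField.Normc.normcM normc_real mulrC ler_wpM2r ?normc_ge0//.
exact: mnorm_entry.
Qed.

(** Any [K'] with [r * K' + K <= s * K'] and [a 0 <= K'] propagates by induction, whence the
    quotient by [s - r]. *)
Lemma perturbed_geometric_bound (a : nat -> R) (r s K : R) :
    0 <= r < s -> (forall n, a n.+1 <= r * a n + K * s ^+ n) ->
  exists K', forall n, a n <= K' * s ^+ n.
Proof.
move=> /andP[r0 rs] Ha; have s0 : 0 < s by apply: le_lt_trans rs.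
have sr : 0 < s - r by rewrite subr_gt0.
exists (`|a 0| + `|K| / (s - r)); elim=> [|n IH].
  rewrite expr0 mulr1 (le_trans (ler_norm _))// lerDl divr_ge0//; exact: ltW.
apply: le_trans (Ha n) _; apply: (le_trans (lerD (ler_wpM2l r0 IH) (lexx _))).
rewrite exprS !mulrA -mulrDl ler_wpM2r ?exprn_ge0 ?(ltW s0)//.
have : `|K| = `|K| / (s - r) * (s - r) by rewrite divfK// gt_eqF.
have := ler_norm K; have := normr_ge0 (a 0); nra.
Qed.

Definition cmnorm m n (M : 'M[R[i]]_(m, n)) : R := \sum_i \sum_j normc (M i j).

Lemma cmnormD m n (M M' : 'M[R[i]]_(m, n)) :
  cmnorm (M + M') <= cmnorm M + cmnorm M'.
Proof.
rewrite /cmnorm -big_split ler_sum//= => i _.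
by rewrite -big_split ler_sum//= => j _; rewrite mxE le_normcD.
Qed.

Lemma cmnormZ m n (z : R[i]) (M : 'M[R[i]]_(m, n)) :
  cmnorm (z *: M) = normc z * cmnorm M.
Proof.
rewrite /cmnorm mulr_sumr; apply: eq_bigr => i _; rewrite mulr_sumr.
by apply: eq_bigr => j _; rewrite mxE ComplexField.Normc.normcM.
Qed.

Lemma cmnorm0 m n : cmnorm (0 : 'M[R[i]]_(m, n)) = 0.
Proof.
rewrite /cmnorm big1// => i _; rewrite big1// => j _.
by rewrite mxE ComplexField.Normc.normc0.
Qed.

Lemma cmnorm_real m n (M : 'M[R]_(m, n)) :
  cmnorm (map_mx (real_complex R) M) = mnorm M.
Proof.
by apply: eq_bigr => i _; apply: eq_bigr => j _; rewrite mxE normc_real.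
Qed.

(* [M ^ (n+1) Z = l M ^ n Z + M ^ n (M - l) Z] removes one root at a time. *)
Lemma split_annihilator_decay d (M : 'M[R[i]]_d) (r s : R) (ls : seq R[i])
    (Z : 'M[R[i]]_d) :
    0 <= r < s -> (forall l, l \in ls -> normc l <= r) ->
    (\prod_(l <- ls) (M - l%:M)) *m Z = 0 ->
  exists K, forall n, cmnorm (M ^+ n *m Z) <= K * s ^+ n.
Proof.
move=> rs; elim/last_ind: ls Z => [|ls l IH] Z lsr.
  rewrite big_nil mul1mx => ->; exists 0 => n.
  by rewrite mulmx0 cmnorm0 mul0r.
rewrite big_rcons /= -mulmxA => /IH [k kls|K HK].
  by apply: lsr; rewrite mem_rcons inE kls orbT.
apply: (perturbed_geometric_bound (K := K) rs) => n.
have -> : M ^+ n.+1 *m Z = l *: (M ^+ n *m Z) + M ^+ n *m ((M - l%:M) *m Z).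
  rewrite mulmxBl mulmxBr mul_scalar_mx -scalemxAr addrC subrK.
  by rewrite exprSr mulmxA.
apply: le_trans (cmnormD _ _) _; rewrite lerD// cmnormZ ler_wpM2r//.
  by apply: sumr_ge0 => i _; apply: sumr_ge0 => j _; exact: normc_ge0.
by apply: lsr; rewrite mem_rcons mem_head.
Qed.

(** By Cayley-Hamilton the product of the factors [M - l] over the roots of the characteristic
    polynomial vanishes, so [split_annihilator_decay] applies with [Z = 1]. *)
Lemma eigenvalues_geometric_bound d (M : 'M[R]_d) (r s : R) :
    0 <= r < s ->
    (forall z, eigenvalue (map_mx (real_complex R) M) z -> normc z <= r) ->
  exists K, forall n, mnorm (M ^+ n) <= K * s ^+ n.
Proof.
case: d M => [|d] M rs Mr.
  by exists 0 => n; rewrite mul0r /mnorm big_ord0.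
set Mc := map_mx _ M in Mr; have [ls Hls] := closed_field_poly_normal (char_poly Mc).
move: Hls; rewrite (monicP (char_poly_monic Mc)) scale1r => Hls.
have [||K HK] := @split_annihilator_decay _ Mc r s ls 1%:M rs.
- move=> l lls; apply: Mr; rewrite eigenvalue_root_char Hls.
  by rewrite root_prod_XsubC.
- rewrite mulmx1; have := Cayley_Hamilton Mc; rewrite Hls rmorph_prod /= => <-.
  by apply: eq_bigr => l _; rewrite rmorphB /= horner_mx_X horner_mx_C.
- exists K => n; rewrite -cmnorm_real map_mx_real_complexX -/Mc.
  by rewrite -[X in cmnorm X]mulmx1.
Qed.

End SpectralRadius.

(** * Limits superior in the extended reals *)

Section LimitSuperior.
Context {R : realType}.
Implicit Types (u v : (\bar R)^nat) (l : \bar R).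
Local Open Scope ereal_scope.

Lemma limn_esup_esups u : limn_esup u = ereal_inf (range (esups u)).
Proof. by rewrite limn_esup_lim; exact/cvg_lim/cvg_esups_inf. Qed.

Lemma limn_esup_lt u l : limn_esup u < l ->
  exists n0, forall n, (n0 <= n)%N -> u n < l.
Proof.
rewrite limn_esup_esups => /ereal_inf_lt [_ [n0 _ <-] ltl].
exists n0 => n n0n; apply: le_lt_trans ltl.
by apply: ereal_sup_ubound; exists n.
Qed.

Lemma limn_esup_le_eventually u l n0 :
  (forall n, (n0 <= n)%N -> u n <= l) -> limn_esup u <= l.
Proof.
move=> ul; rewrite limn_esup_esups; apply: (@le_trans _ _ (esups u n0)).
  by apply: ereal_inf_lbound; exists n0.
by apply: ge_ereal_sup => _ [n /= n0n <-]; exact: ul.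
Qed.

Lemma le_limn_esup u v : (forall n, u n <= v n) -> limn_esup u <= limn_esup v.
Proof.
move=> uv; rewrite !limn_esup_esups; apply: le_ereal_inf_tmp => _ [n _ <-].
apply: (@le_trans _ _ (esups u n)); first by apply: ereal_inf_lbound; exists n.
apply: ge_ereal_sup => _ [k /= nk <-]; apply: (le_trans (uv k)).
by apply: ereal_sup_ubound; exists k.
Qed.

Lemma limn_esup_ge u l : (forall n, l <= u n) -> l <= limn_esup u.
Proof.
move=> lu; rewrite limn_esup_esups; apply: le_ereal_inf_tmp => _ [n _ <-].
by apply: (le_trans (lu n)); apply: ereal_sup_ubound; exists n => /=.
Qed.

End LimitSuperior.

(** * Induced operator norms *)

Section InducedNorm.
Context {R : realType} {d : nat} (p : 'cV[R]_d -> R).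
Hypothesis pP : is_vector_norm p.
Implicit Types M : 'M[R]_d.

Lemma induced_norm_le M c : (forall x, p (M *m x) <= c * p x) -> 0 <= c ->
  induced_norm p M <= c.
Proof.
move=> Mc c0; apply: ge_sup.
  by exists (p (M *m 0)); exists 0 => //=; rewrite (vnorm0 pP).
move=> _ [x /= x1 <-]; apply: (le_trans (Mc x)).
by rewrite -[leRHS]mulr1 ler_wpM2l.
Qed.

Let has_ubound_induced_norm M :
  has_ubound [set p (M *m x) | x in [set x | p x <= 1]].
Proof.
have [C C0 HC] := vnorm_le_mnorm pP; have [C' C'0 HC'] := mnorm_le_vnorm pP.
exists (C * (mnorm M * C')) => _ [x /= x1 <-].
rewrite (le_trans (HC _))// ler_wpM2l ?(ltW C0)// (le_trans (mnormM _ _))//.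
rewrite ler_wpM2l ?mnorm_ge0// (le_trans (HC' _))//.
by rewrite -[leRHS]mulr1 ler_wpM2l// ltW.
Qed.

Lemma induced_norm_ge0 M : 0 <= induced_norm p M.
Proof.
apply: (@le_trans _ _ (p (M *m 0))); first exact: vnorm_ge0.
by apply: ub_le_sup => //; exists 0 => //=; rewrite (vnorm0 pP).
Qed.

Lemma induced_norm_ub M x : p (M *m x) <= induced_norm p M * p x.
Proof.
have [px0|px0] := eqVneq (p x) 0.
  by rewrite (vnorm_eq0 pP px0) mulmx0 (vnorm0 pP) mulr0.
have px : 0 < p x by rewrite lt_def px0 (vnorm_ge0 pP).
rewrite -ler_pdivrMr// mulrC -[(p x)^-1]gtr0_norm ?invr_gt0//.
rewrite -(vnormZ pP) scalemxAr; apply: ub_le_sup => //.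
exists ((p x)^-1 *: x) => //=.
by rewrite (vnormZ pP) gtr0_norm ?invr_gt0// mulVf.
Qed.

Lemma induced_normM M M' :
  induced_norm p (M *m M') <= induced_norm p M * induced_norm p M'.
Proof.
apply: induced_norm_le => [x|]; last by rewrite mulr_ge0 ?induced_norm_ge0.
rewrite -mulmxA (le_trans (induced_norm_ub _ _))// -mulrA.
by rewrite ler_wpM2l ?induced_norm_ge0 ?induced_norm_ub.
Qed.

Lemma induced_norm_le_mnorm :
  exists2 C, 0 < C & forall M, induced_norm p M <= C * mnorm M.
Proof.
have [C C0 HC] := vnorm_le_mnorm pP; have [C' C'0 HC'] := mnorm_le_vnorm pP.
exists (C * C') => [|M]; first exact: mulr_gt0.
apply: induced_norm_le => [x|]; last by rewrite !mulr_ge0 ?mnorm_ge0 ?ltW.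
rewrite (le_trans (HC _))// -!mulrA ler_wpM2l ?(ltW C0)//.
rewrite (le_trans (mnormM _ _))// mulrCA ler_wpM2l ?mnorm_ge0//.
Qed.

(** The columns of [M] are the images of the basis vectors. The added 1 keeps the constant positive
    when there are none. *)
Lemma mnorm_le_induced_norm :
  exists2 C, 0 < C & forall M, mnorm M <= C * induced_norm p M.
Proof.
have [C C0 HC] := mnorm_le_vnorm pP.
have S0 : 0 <= \sum_i p (delta_mx i 0) by rewrite sumr_ge0// => i _; exact: vnorm_ge0.
exists (C * (\sum_i p (delta_mx i 0)) + 1) => [|M].
  by rewrite ltr_wpDl// mulr_ge0// ltW.
apply: (@le_trans _ _ (C * (\sum_i p (delta_mx i 0)) * induced_norm p M)); last first.
  by rewrite ler_wpM2r ?induced_norm_ge0// lerDl.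
rewrite -mulrA mulr_suml mulr_sumr -mnorm_tr ler_sum// => i _.
apply: (@le_trans _ _ (C * p (M *m delta_mx i 0))); last first.
  by rewrite ler_wpM2l ?(ltW C0)// mulrC induced_norm_ub.
apply: le_trans (HC _); rewrite -colE /mnorm ler_sum// => j _.
by rewrite big_ord1 !mxE.
Qed.

End InducedNorm.

(** * Means over Markov words *)

Section MarkovWords.
Context {R : realType} {N : nat}.
Implicit Types (w : seq 'I_N) (g : seq 'I_N -> R).

Lemma sum_tuple_cons n (f : seq 'I_N -> R) :
  \sum_(w : n.+1.-tuple 'I_N) f w = \sum_x \sum_(w : n.-tuple 'I_N) f (x :: w).
Proof.
rewrite pair_big /=.
pose h (q : 'I_N * n.-tuple 'I_N) := cons_tuple q.1 q.2.
have hinj : injective h.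
  by move=> [x u] [y v] /(congr1 val) /= [-> uv]; congr (_, _); exact: val_inj.
rewrite (reindex h)//; apply/onW_bij/(inj_card_bij hinj).
by rewrite card_prod !card_tuple expnS.
Qed.

Lemma sum_tuple_rcons n (f : seq 'I_N -> R) :
  \sum_(w : n.+1.-tuple 'I_N) f w = \sum_(w : n.-tuple 'I_N) \sum_x f (rcons w x).
Proof.
rewrite pair_big /=.
pose h (q : n.-tuple 'I_N * 'I_N) := rcons_tuple q.1 q.2.
have hinj : injective h.
  move=> [u x] [v y] /(congr1 val) /= /rcons_inj [uv ->]; congr (_, _).
  exact: val_inj.
rewrite (reindex h)//; apply/onW_bij/(inj_card_bij hinj).
by rewrite card_prod !card_tuple expnSr.
Qed.

(** The value 1 on the empty word is the total mass, so that the marginal identities below hold from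
    length 0 on. *)
Definition path_weight (nu : 'rV[R]_N) (P : 'M[R]_N) w : R :=
  if w is x :: w' then nu 0 x * \prod_(e <- zip w w') P e.1 e.2 else 1.

Definition markov_mean nu P n g : R :=
  \sum_(w : n.-tuple 'I_N) path_weight nu P w * g w.

Lemma word_weight_path nu P n (w : n.+1.-tuple 'I_N) :
  word_weight nu P w = path_weight nu P w.
Proof. by case/tupleP: w => x w; rewrite /word_weight theadE. Qed.

Variables (nu : 'rV[R]_N) (P : 'M[R]_N).
Hypotheses (Psto : stochastic P) (nuP : invariant_probability P nu).

Lemma path_weight_ge0 w : 0 <= path_weight nu P w.
Proof.
case: w => //= x w; rewrite mulr_ge0//; first by case: nuP.
by rewrite prodr_ge0// => e _; case: Psto.
Qed.

Lemma path_weight_rcons x w y :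
  path_weight nu P (rcons (x :: w) y) = path_weight nu P (x :: w) * P (last x w) y.
Proof.
rewrite /= -mulrA; congr (_ * _); elim: w x => [|z w IH] x /=.
  by rewrite !big_cons !big_nil mulr1 mul1r.
by rewrite big_cons IH big_cons mulrA.
Qed.

(** Forgetting the last letter uses that the rows of [P] sum to 1. *)
Lemma sum_path_weight_rcons w : \sum_y path_weight nu P (rcons w y) = path_weight nu P w.
Proof.
case: w => [|x w].
  rewrite /= -[RHS](_ : \sum_y nu 0 y = 1); last by case: nuP.
  by apply: eq_bigr => y _; rewrite big_nil mulr1.
under eq_bigr do rewrite path_weight_rcons.
by rewrite -mulr_sumr; case: Psto => _ ->; rewrite mulr1.
Qed.

(** Forgetting the first letter uses the stationarity of [nu]. *)
Lemma sum_path_weight_cons w : \sum_x path_weight nu P (x :: w) = path_weight nu P w.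
Proof.
case: w => [|y w].
  rewrite /= -[RHS](_ : \sum_y nu 0 y = 1); last by case: nuP.
  by apply: eq_bigr => y _; rewrite big_nil mulr1.
rewrite /=; under eq_bigr do rewrite big_cons mulrA.
rewrite -mulr_suml; congr (_ * _); case: nuP => _ _ {2}->.
by rewrite mxE.
Qed.

Lemma markov_mean_take n k g :
  markov_mean nu P (n + k) (g \o take n) = markov_mean nu P n g.
Proof.
elim: k => [|k IH].
  rewrite addn0; apply: eq_bigr => w _ /=.
  by rewrite take_oversize// size_tuple.
rewrite addnS -IH /markov_mean.
rewrite (sum_tuple_rcons _ (fun w => path_weight nu P w * g (take n w))).
apply: eq_bigr => w _ /=; rewrite -sum_path_weight_rcons mulr_suml.
by apply: eq_bigr => x _; rewrite -cats1 takel_cat// size_tuple leq_addr.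
Qed.

Lemma markov_mean_drop n k g :
  markov_mean nu P (k + n) (g \o drop k) = markov_mean nu P n g.
Proof.
elim: k => [|k IH].
  by rewrite add0n; apply: eq_bigr => w _ /=; rewrite drop0.
rewrite addSn -IH /markov_mean.
rewrite (sum_tuple_cons _ (fun w => path_weight nu P w * g (drop k.+1 w))).
rewrite exchange_big; apply: eq_bigr => w _ /=.
by rewrite -mulr_suml sum_path_weight_cons.
Qed.

Lemma markov_mean_le n g h : (forall w, size w = n -> g w <= h w) ->
  markov_mean nu P n g <= markov_mean nu P n h.
Proof.
move=> gh; apply: ler_sum => w _; rewrite ler_wpM2l ?path_weight_ge0//.
by apply: gh; rewrite size_tuple.
Qed.

Lemma markov_mean_cst n c : markov_mean nu P n (fun=> c) = c.
Proof.
rewrite -[RHS](_ : markov_mean nu P 0 (fun=> c) = c).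
  by rewrite -(markov_mean_take 0 n).
rewrite /markov_mean (big_pred1 [tuple]) => [|w]; first by rewrite mul1r.
by apply/esym/eqP; exact: tuple0.
Qed.

Lemma markov_mean_lin n a b g h :
  markov_mean nu P n (fun w => a * g w + b * h w)
  = a * markov_mean nu P n g + b * markov_mean nu P n h.
Proof.
rewrite /markov_mean !mulr_sumr -big_split /=.
by apply: eq_bigr => w _; ring.
Qed.

End MarkovWords.

Lemma subadditive_bound {R : realType} (u : nat -> R) T q t :
  (forall a b, u (a + b)%N <= u a + u b) -> u 0 = 0 ->
  u (q * T + t)%N <= q%:R * u T + t%:R * u 1.
Proof.
move=> usub u0; apply: le_trans (usub _ _) _; rewrite lerD//.
  elim: q => [|q IH]; first by rewrite mul0n u0 mul0r.
  by rewrite mulSn -natr1 mulrDl mul1r addrC (le_trans (usub _ _))// lerD2l.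
elim: t => [|t IH]; first by rewrite u0 mul0r.
by rewrite -addn1 natrD mulrDl mul1r (le_trans (usub _ _))// lerD2r.
Qed.

(** * Subadditivity of the mean growth along a stationary chain *)

Section MarkovGrowth.
Context {R : realType} {d N : nat} (A : 'I_N -> 'M[R]_d).

Definition mean_growth nu P (p : 'cV[R]_d -> R) n : R :=
  markov_mean nu P n (fun w => induced_norm p (word_prod A w) `^ (n%:R^-1)).

Lemma rho_p_markovE p nu P : rho_p_markov p nu P A =
  limn_esup (fun n => (mean_growth nu P p n.+1)%:E).
Proof.
congr limn_esup; apply/funext => n; congr (_%:E).
by apply: eq_bigr => w _; rewrite word_weight_path.
Qed.

(** Young's inequality for the roots of order [a + b], with the conjugate exponents [(a + b) / a]
    and [(a + b) / b]. *)
Lemma weighted_AGM (a b : nat) (X Y : R) : (0 < a)%N -> (0 < b)%N ->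
    0 <= X -> 0 <= Y ->
  (a + b)%:R * (X * Y) `^ ((a + b)%:R^-1)
    <= a%:R * X `^ (a%:R^-1) + b%:R * Y `^ (b%:R^-1).
Proof.
move=> a0 b0 X0 Y0.
have aR : 0 < a%:R :> R by rewrite ltr0n.
have bR : 0 < b%:R :> R by rewrite ltr0n.
have ab : 0 < (a + b)%:R :> R by rewrite ltr0n addn_gt0 a0.
have := @conjugate_powR R (X `^ (a + b)%:R^-1) (Y `^ (a + b)%:R^-1)
  ((a + b)%:R / a%:R) ((a + b)%:R / b%:R) (powR_ge0 _ _) (powR_ge0 _ _)
  (divr_gt0 ab aR) (divr_gt0 ab bR).
rewrite -!powRrM !mulKf ?(gt_eqF ab)// !invf_div -mulrDl -natrD.
rewrite divff ?(gt_eqF ab)// -powRM// => /(_ erefl).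
rewrite -(ler_pM2l ab); congr (_ <= _).
by field; rewrite -natrD (gt_eqF ab) .
Qed.

Variables (nu : 'rV[R]_N) (P : 'M[R]_N).
Hypotheses (Psto : stochastic P) (nuP : invariant_probability P nu).

Lemma mean_growth_ge0 p n : 0 <= mean_growth nu P p n.
Proof.
by apply: sumr_ge0 => w _; rewrite mulr_ge0 ?powR_ge0 ?path_weight_ge0.
Qed.

(** A word splits into a prefix and a suffix, whose laws are those of shorter stationary words;
    submultiplicativity and [weighted_AGM] then apply word by word. *)
Lemma mean_growth_subadditive p a b : is_vector_norm p ->
  (a + b)%:R * mean_growth nu P p (a + b)
    <= a%:R * mean_growth nu P p a + b%:R * mean_growth nu P p b.
Proof.
move=> pP; case: a => [|a]; first by rewrite add0n mul0r add0r.
case: b => [|b]; first by rewrite addn0 mul0r addr0.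
rewrite -[X in _ <= a.+1%:R * X + _](markov_mean_take Psto nuP _ b.+1).
rewrite -[X in _ <= _ + b.+1%:R * X](markov_mean_drop nuP _ a.+1).
(* The null term gives the left side the shape required by [markov_mean_lin]. *)
rewrite -markov_mean_lin -[leLHS]addr0 -(mul0r (markov_mean nu P (a.+1 + b.+1) (fun=> 0))).
rewrite -markov_mean_lin; apply: markov_mean_le => // w wab /=.
rewrite mul0r addr0.
apply: le_trans (weighted_AGM _ _ (induced_norm_ge0 pP _) (induced_norm_ge0 pP _)) => //.
rewrite ler_wpM2l// ge0_ler_powR ?invr_ge0 ?nnegrE ?mulr_ge0 ?induced_norm_ge0//.
rewrite -{1}[w](cat_take_drop a.+1) word_prod_cat mulrC; exact: induced_normM.
Qed.

(** Fekete's argument: divide [n] by [T] and bound the remainder by [T]. *)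
Lemma mean_growth_le_multiple p T n : is_vector_norm p -> (0 < T)%N -> (0 < n)%N ->
  mean_growth nu P p n <= mean_growth nu P p T + T%:R * mean_growth nu P p 1 / n%:R.
Proof.
move=> pP T0 n0.
have := @subadditive_bound R (fun n => n%:R * mean_growth nu P p n) T (n %/ T) (n %% T)
  (fun a b => mean_growth_subadditive a b pP) (mul0r _).
rewrite -divn_eq mul1r mulrA -natrM => H.
have nR : 0 < n%:R :> R by rewrite ltr0n.
rewrite -(ler_pM2l nR) mulrDr [X in _ <= _ + X]mulrC divfK ?(gt_eqF nR)//.
apply: le_trans H _; rewrite lerD// ler_wpM2r ?mean_growth_ge0// ler_nat.
  exact: leq_trunc_div.
by rewrite ltnW// ltn_mod.
Qed.

(** Changing the norm costs a constant factor [k], whose root of order [n] tends to 1, and the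
    remainder in [mean_growth_le_multiple] tends to 0. *)
Lemma rho_p_markov_le nrm p T : is_vector_norm nrm -> is_vector_norm p ->
  (0 < T)%N -> (rho_p_markov nrm nu P A <= (mean_growth nu P p T)%:E)%E.
Proof.
move=> nrmP pP T0; rewrite rho_p_markovE; apply/lee_addgt0Pr => e e0.
have [C1 C10 HC1] := induced_norm_le_mnorm nrmP.
have [C2 C20 HC2] := mnorm_le_induced_norm pP.
pose k := C1 * C2; have k0 : 0 < k by apply: mulr_gt0.
have Hk M : induced_norm nrm M <= k * induced_norm p M.
  by rewrite (le_trans (HC1 M))// -mulrA ler_wpM2l// ltW.
set f := mean_growth nu P p T; have f0 : 0 <= f by apply: mean_growth_ge0.
pose B := T%:R * mean_growth nu P p 1.
(* As [delta <= 1], [(1 + delta) * (f + delta)] is at most [f + delta * (f + 2)], hence at most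
   [f + e]. *)
pose delta := Num.min 1 (e / (f + 2)).
have f20 : 0 < f + 2 by rewrite ltr_wpDl.
have delta0 : 0 < delta by rewrite lt_min ltr01 divr_gt0.
have delta1 : delta <= 1 by rewrite ge_min lexx.
have deltae : delta * (f + 2) <= e by rewrite -ler_pdivlMr// ge_min lexx orbT.
have d1 : 1 < 1 + delta by rewrite ltrDl.
have [||n1 Hn1] := @expr_eventually_lt R (1 + delta)^-1 k^-1.
- by rewrite invr_ge0 invf_lt1 ?d1 ?addr_ge0 ?ltW ?addr_gt0.
- by rewrite invr_gt0.
apply: (limn_esup_le_eventually (n0 := maxn n1 (Num.truncn (B / delta)).+1)).
move=> n; rewrite geq_max => /andP[n1n Bn]; rewrite -EFinD lee_fin.
have nR : 0 < n.+1%:R :> R by rewrite ltr0n.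
have kn : k `^ n.+1%:R^-1 <= 1 + delta.
  have d10 : 0 < 1 + delta := lt_trans ltr01 d1.
  rewrite -[leRHS](powRr1 (ltW d10)) -[X in _ <= _ `^ X](mulfV (lt0r_neq0 nR)).
  rewrite powRrM powR_mulrn ?(ltW d10)// ge0_ler_powR ?invr_ge0 ?nnegrE ?(ltW k0)//.
    by rewrite exprn_ge0 ?(ltW d10).
  rewrite -lef_pV2 ?posrE ?(exprn_gt0 _ d10)//.
  by rewrite -exprVn; apply/ltW/Hn1/leqW.
have Bd : B / n.+1%:R <= delta.
  rewrite ler_pdivrMr// mulrC -ler_pdivrMr// (le_trans (ltW (truncnS_gt _)))//.
  by rewrite ler_nat (leq_trans Bn).
apply: (@le_trans _ _ (k `^ n.+1%:R^-1 * mean_growth nu P p n.+1)).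
  rewrite -[leRHS]addr0 -(mul0r (markov_mean nu P n.+1 (fun=> 0))).
  rewrite /mean_growth -markov_mean_lin; apply: markov_mean_le => // w _.
  rewrite mul0r addr0 -powRM ?induced_norm_ge0 ?(ltW k0)//.
  have kp0 := mulr_ge0 (ltW k0) (induced_norm_ge0 pP (word_prod A w)).
  by rewrite ge0_ler_powR ?invr_ge0 ?nnegrE ?(induced_norm_ge0 nrmP).
have := mean_growth_le_multiple pP T0 (ltn0Sn n); rewrite -/f -/B => Hn.
apply: (@le_trans _ _ ((1 + delta) * (f + delta))).
  apply: ler_pM (powR_ge0 _ _) (mean_growth_ge0 _ _) kn _.
  by apply: le_trans Hn _; rewrite lerD2l.
nra.
Qed.

End MarkovGrowth.

Lemma root_exprK {R : realType} (x : R) n : (0 < n)%N -> 0 <= x ->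
  (x `^ n%:R^-1) ^+ n = x.
Proof.
move=> n0 x0; rewrite -powR_mulrn ?powR_ge0// -powRrM mulVf ?powRr1//.
by rewrite pnatr_eq0 -lt0n.
Qed.

Lemma root_le {R : realType} (x c : R) n : (0 < n)%N -> 0 <= x -> 0 <= c ->
  (x `^ n%:R^-1 <= c) = (x <= c ^+ n).
Proof.
by move=> n0 x0 c0; rewrite -(ler_pXn2r n0) ?nnegrE ?powR_ge0// root_exprK.
Qed.

Lemma root_lt {R : realType} (x c : R) n : (0 < n)%N -> 0 <= x -> 0 <= c ->
  (x `^ n%:R^-1 < c) = (x < c ^+ n).
Proof.
by move=> n0 x0 c0; rewrite -(ltr_pXn2r n0) ?nnegrE ?powR_ge0// root_exprK.
Qed.

Lemma traject_period (T : Type) (f : T -> T) x k m : iter k f x = x ->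
  traject f x (m * k) = flatten (nseq m (traject f x k)).
Proof. by move=> fx; elim: m => // m IH; rewrite mulSn trajectD fx IH. Qed.

(** * Finiteness of [rho_d] and comparison with [rho_p] *)

Section Bounds.
Context {R : realType} {d N : nat} (A : 'I_N -> 'M[R]_d).

Lemma word_prod_exp_bound : exists K M : R, [/\ 0 < K, 1 <= M &
  forall w, mnorm (word_prod A w) <= K * M ^+ size w].
Proof.
exists (mnorm (1%:M : 'M[R]_d) + 1), (1 + \sum_i mnorm (A i)); split.
- by rewrite ltr_wpDl// mnorm_ge0.
- by rewrite lerDl sumr_ge0// => i _; exact: mnorm_ge0.
have M0 : 0 <= 1 + \sum_i mnorm (A i).
  by rewrite addr_ge0// sumr_ge0// => i _; exact: mnorm_ge0.
elim=> [|i w IH]; first by rewrite word_prod_nil expr0 mulr1 lerDl.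
rewrite word_prod_cons exprSr mulrA (le_trans (mnormM _ _))//.
rewrite ler_pM ?mnorm_ge0// (bigD1 i)//= addrCA lerDl addr_ge0//.
by rewrite sumr_ge0// => j _; exact: mnorm_ge0.
Qed.

Variable nrm : 'cV[R]_d -> R.
Hypothesis nrmP : is_vector_norm nrm.

Lemma induced_norm_word_bound : exists2 M, 0 <= M &
  forall w, induced_norm nrm (word_prod A w) <= M ^+ size w.
Proof.
exists (\sum_i induced_norm nrm (A i)).
  by rewrite sumr_ge0// => i _; exact: induced_norm_ge0.
elim=> [|i w IH].
  by rewrite word_prod_nil expr0; apply: induced_norm_le => // x; rewrite mul1mx mul1r.
rewrite word_prod_cons exprSr (le_trans (induced_normM nrmP _ _))//.
rewrite ler_pM ?induced_norm_ge0// (bigD1 i)//= lerDl.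
by rewrite sumr_ge0// => j _; exact: induced_norm_ge0.
Qed.

Let max_growth n : R := \big[Num.max/0]_(w : n.+1.-tuple 'I_N)
  induced_norm nrm (word_prod A w) `^ (n.+1%:R^-1).

Lemma rho_d_fin : exists2 r : R, 0 <= r & rho_d nrm A = r%:E.
Proof.
have [M M0 HM] := induced_norm_word_bound.
have ge0 : (0%:E <= rho_d nrm A)%E.
  by apply: limn_esup_ge => n; rewrite lee_fin bigmax_ge_id.
have leM : (rho_d nrm A <= M%:E)%E.
  apply: (@limn_esup_le_eventually _ _ _ 0) => n _.
  rewrite lee_fin; apply/bigmax_leP; split=> // w _.
  by rewrite root_le ?induced_norm_ge0// -[X in M ^+ X](size_tuple w).
exists (fine (rho_d nrm A)); first by rewrite fine_ge0.
by rewrite fineK// fin_numE -ltey -ltNye (lt_le_trans _ ge0) ?(le_lt_trans leM) ?ltNyr ?ltry.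
Qed.

Lemma rho_d_word_bound (s : R) : 0 < s -> (rho_d nrm A < s%:E)%E ->
  exists n0, forall w, (n0 < size w)%N ->
    induced_norm nrm (word_prod A w) <= s ^+ size w.
Proof.
(* The term of index [n] is about words of length [n.+1], hence the strict bound on the length. *)
move=> s0 /limn_esup_lt [n0 Hn0]; exists n0 => w; case Ew: (size w) => [//|n] nn.
have sw : size w == n.+1 by rewrite Ew.
have := Hn0 n nn; rewrite lte_fin => /ltW.
move=> /(le_trans (le_bigmax _ _ (Tuple sw))) /=.
by rewrite root_le ?induced_norm_ge0 ?(ltW s0).
Qed.

Lemma rho_p_markov_le_rho_d nu P : stochastic P -> invariant_probability P nu ->
  (rho_p_markov nrm nu P A <= rho_d nrm A)%E.
Proof.
move=> Psto nuP; rewrite rho_p_markovE; apply: le_limn_esup => n.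
rewrite lee_fin; apply: (@le_trans _ _ (markov_mean nu P n.+1 (fun=> max_growth n))); last first.
  by rewrite (markov_mean_cst Psto nuP).
apply: markov_mean_le => // w /eqP sw.
exact: (le_bigmax _ (fun w : n.+1.-tuple 'I_N => induced_norm nrm (word_prod A w)
  `^ (n.+1%:R^-1)) (Tuple sw)).
Qed.

Lemma rho_p_le_rho_d : (rho_p nrm A <= rho_d nrm A)%E.
Proof.
apply: ge_ereal_sup => _ [[nu P] /= [Psto nuP] <-].
exact: rho_p_markov_le_rho_d.
Qed.

Lemma rho_p_markov_ge0 nu P : stochastic P -> invariant_probability P nu ->
  (0%:E <= rho_p_markov nrm nu P A)%E.
Proof.
move=> Psto nuP; rewrite rho_p_markovE; apply: limn_esup_ge => n.
by rewrite lee_fin mean_growth_ge0.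
Qed.

End Bounds.

(** * Cycles *)

Section CyclicChain.
Context {R : realType} {N : nat} (c : seq 'I_N).
Hypotheses (c_uniq : uniq c) (c_gt0 : (0 < size c)%N).

Definition cycle_nu : 'rV[R]_N := \row_i (if i \in c then (size c)%:R^-1 else 0).
(** The deterministic rotation along [c]; [next c] fixes the letters outside [c], so every row has
    sum 1. *)
Definition cycle_mx : 'M[R]_N := \matrix_(i, j) (j == next c i)%:R.

Lemma cycle_mx_stochastic : stochastic cycle_mx.
Proof.
split=> [i j|i]; first by rewrite mxE ler0n.
rewrite (bigD1 (next c i))//= mxE eqxx big1 ?addr0// => j /negbTE jn.
by rewrite mxE jn.
Qed.

Lemma cycle_nu_invariant : invariant_probability cycle_mx cycle_nu.
Proof.
split=> [i||].
- by rewrite mxE; case: ifP => // _; rewrite invr_ge0.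
- under eq_bigr do rewrite mxE.
  rewrite -big_mkcond /= sumr_const (card_uniqP c_uniq) -[LHS]mulr_natr mulVf//.
  by rewrite pnatr_eq0 -lt0n.
apply/rowP => j; rewrite [RHS]mxE (bigD1 (prev c j))//= !mxE mem_prev.
rewrite next_prev// eqxx mulr1 big1 ?addr0// => i ij; rewrite !mxE.
case: eqP => [ji|_]; last by rewrite mulr0.
by rewrite ji prev_next// eqxx in ij.
Qed.

Lemma cycle_path_support w : path_weight cycle_nu cycle_mx w != 0 ->
  w = [::] \/ exists2 x, x \in c & w = traject (next c) x (size w).
Proof.
case: w => [|x w]; [by left | rewrite /= mulf_eq0 negb_or => /andP[nux Pw]; right].
exists x.
  by apply: contraNT nux => /negbTE xc; rewrite mxE xc.
congr (_ :: _); apply: fpathE; move: Pw {nux}.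
elim: w x => //= y w IH x; rewrite big_cons mulf_eq0 negb_or /= => /andP[].
by rewrite mxE pnatr_eq0 eqb0 negbK eq_sym => -> /IH.
Qed.

Lemma cycle_traject : exists c0, c = traject (next c) c0 (size c) /\
  iter (size c) (next c) c0 = c0.
Proof.
move: (next c) (cycle_next c_uniq) c_gt0 => f; case: (c) => [//|c0 c'] fc _.
exists c0; split; first by rewrite -(fcycle_consE fc).
have := fcycle_rconsE fc; rewrite trajectSr.
by rewrite -(fcycle_consE fc) => /rcons_inj [].
Qed.

(** A path of the chain may start anywhere on the cycle; it is a power of [c] up to two end pieces
    of bounded length. *)
Lemma subword_cycle_pow x m : x \in c -> exists u v,
  [/\ (size u <= size c)%N, (size v <= size c)%N &
      word_pow c m.+1 = u ++ traject (next c) x (m * size c) ++ v].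
Proof.
have [c0 [cE it]] := cycle_traject; set k := size c in cE it *.
rewrite {1}cE => /trajectP [i ik ->].
(* Here [x] is the letter of rank [i]: [u] leads from [c0] to [x], and [v] completes the last
   turn. *)
exists (traject (next c) c0 i), (traject (next c) (iter (i + m * k) (next c) c0) (k - i)).
rewrite !size_traject leq_subr (ltnW ik); split=> //.
rewrite /word_pow {1}cE -traject_period//.
have -> : (m.+1 * k = i + (m * k + (k - i)))%N.
  by rewrite addnCA subnKC ?(ltnW ik)// mulSn addnC.
by rewrite !trajectD -iterD addnC.
Qed.

End CyclicChain.

(** * Simple cycles bound [rho_p] from below *)

Section LowerBound.
Context {R : realType} {d N : nat} (A : 'I_N -> 'M[R]_d) (nrm : 'cV[R]_d -> R).
Hypothesis nrmP : is_vector_norm nrm.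
Local Notation normc := ComplexField.Normc.normc.

Lemma markov_mean_ge_support nu P n g (b : R) :
    stochastic P -> @invariant_probability R N P nu ->
    (forall w, size w = n -> path_weight nu P w != 0 -> b <= g w) ->
  b <= markov_mean nu P n g.
Proof.
move=> Psto nuP H; rewrite -(markov_mean_cst Psto nuP n b).
apply: ler_sum => w _; have [->|w0] := eqVneq (path_weight nu P w) 0.
  by rewrite !mul0r.
by rewrite ler_wpM2l ?path_weight_ge0// H// size_tuple.
Qed.

(** Every path of length [m * k] of the cyclic chain has a product of norm at least a constant times
    [normc z ^+ m], and the constant disappears in the root of order [m * k]. *)
Lemma eigenvalue_root_le_rho_p (c : seq 'I_N) (z : R[i]) :
    uniq c -> (0 < size c)%N ->
    eigenvalue (map_mx (real_complex R) (word_prod A c)) z ->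
  ((normc z `^ ((size c)%:R^-1))%:E <= rho_p nrm A)%E.
Proof.
move=> c_uniq c_gt0 zc; set k := size c in c_gt0 *.
have Psto := @cycle_mx_stochastic R N c.
have nuP := @cycle_nu_invariant R N c c_uniq c_gt0.
set P := cycle_mx c in Psto nuP; set nu := cycle_nu c in nuP.
apply: (@le_trans _ _ (rho_p_markov nrm nu P A)); last first.
  by apply: ereal_sup_ubound; exists (nu, P).
have rho0 := rho_p_markov_ge0 A nrm Psto nuP.
have [->|z0] := eqVneq (normc z) 0.
  by rewrite powR0// invr_eq0 pnatr_eq0 -lt0n.
have zgt0 : 0 < normc z by rewrite lt_def z0 normc_ge0.
set a := normc z `^ k%:R^-1; rewrite leNgt; apply/negP => lta.
have a0 : 0 <= a := powR_ge0 _ _.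
have fin : rho_p_markov nrm nu P A \is a fin_num.
  by rewrite fin_numE -ltey -ltNye (lt_le_trans _ rho0) ?(lt_trans lta) ?ltNyr ?ltry.
move: rho0 lta; rewrite -(fineK fin) lee_fin lte_fin; set rho := fine _ => rho0 rhoa.
(* A value strictly between the two: the mean is eventually below [s], but at some large multiple of
   [k] it is at least [s]. *)
pose s := (rho + a) / 2.
have s0 : 0 < s by move: rho0 rhoa; rewrite /s -/a; clearbody rho a; lra.
have sa : s < a by move: rhoa; rewrite /s -/a; clearbody rho a; lra.
have : (rho_p_markov nrm nu P A < s%:E)%E.
  by rewrite -(fineK fin) lte_fin /s -/rho; lra.
rewrite rho_p_markovE => /limn_esup_lt [n0 Hn0].
have [cz cz0 Hcz] := eigenvalue_expr_le_mnorm zc.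
have [K [M [K0 M1 HKM]]] := word_prod_exp_bound A.
have [C C0 HC] := mnorm_le_induced_norm nrmP.
pose D := K * M ^+ k.
have M0 : 0 < M := lt_le_trans ltr01 M1.
have D0 : 0 < D by rewrite mulr_gt0// exprn_gt0.
have HD w : (size w <= k)%N -> mnorm (word_prod A w) <= D.
  by move=> wk; rewrite (le_trans (HKM w))// ler_wpM2l ?(ltW K0)// ler_weXn2l.
(* Each [D] pays for an end piece, [C] for the change of norm; the factor [normc z] comes from the
   extra turn in [word_pow c m.+1]. *)
pose kappa := cz * normc z / (D * D * C).
have DDC0 : 0 < D * D * C := mulr_gt0 (mulr_gt0 D0 D0) C0.
have kappa0 : 0 < kappa := divr_gt0 (mulr_gt0 cz0 zgt0) DDC0.
have lower m w : (0 < m)%N -> size w = (m * k)%N -> path_weight nu P w != 0 ->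
    kappa * normc z ^+ m <= induced_norm nrm (word_prod A w).
  move=> m0 sw /cycle_path_support [w0|[x xc wE]].
    by move: sw; rewrite w0 => /esym/eqP; rewrite muln_eq0 !eqn0Ngt m0 c_gt0.
  have [u [v [uk vk cE]]] := subword_cycle_pow c_uniq c_gt0 m xc.
  rewrite /kappa mulrAC (ler_pdivrMr _ _ DDC0) -[leLHS]mulrA -exprS.
  apply: le_trans (Hcz m.+1) _; rewrite -word_prod_pow cE -/k -sw -wE.
  have -> : induced_norm nrm (word_prod A w) * (D * D * C)
      = D * (C * induced_norm nrm (word_prod A w)) * D by ring.
  rewrite !word_prod_cat; apply: le_trans (mnormM _ _) _.
  apply: ler_pM (mnorm_ge0 _) (mnorm_ge0 _) _ (HD _ uk).
  apply: le_trans (mnormM _ _) _.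
  exact: ler_pM (mnorm_ge0 _) (mnorm_ge0 _) (HD _ vk) (HC _).
have sk : 0 <= s ^+ k / normc z < 1.
  rewrite divr_ge0 ?exprn_ge0 ?(ltW s0) ?(ltW zgt0)//= ltr_pdivrMr// mul1r.
  by rewrite -(root_exprK c_gt0 (ltW zgt0)) ltr_pXn2r ?nnegrE ?(ltW s0).
have [m1 Hm1] := expr_eventually_lt sk kappa0.
(* Beyond [m1], and large enough for the shifted index [m * k - 1] to reach [n0]. *)
pose m := (maxn m1 n0).+1.
have mk : (0 < m * k)%N by rewrite muln_gt0.
have := Hn0 (m * k).-1; rewrite prednK// lte_fin.
have -> : (n0 <= (m * k).-1)%N.
  rewrite -ltnS prednK// (@leq_trans m) ?leq_pmulr//.
  by rewrite /m ltnS leq_maxr.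
move=> /(_ isT); apply/negP; rewrite -leNgt.
apply: (@le_trans _ _ ((kappa * normc z ^+ m) `^ (m * k)%:R^-1)); last first.
  apply: markov_mean_ge_support => // w sw w0.
  have kz0 : 0 <= kappa * normc z ^+ m by rewrite mulr_ge0 ?exprn_ge0 ?(ltW kappa0) ?normc_ge0.
  rewrite ge0_ler_powR ?invr_ge0 ?nnegrE ?induced_norm_ge0//.
  exact: lower.
rewrite leNgt root_lt ?(ltW s0)//; last first.
  by rewrite mulr_ge0 ?exprn_ge0 ?(ltW kappa0) ?normc_ge0.
rewrite -leNgt mulnC exprM -ler_pdivrMr ?exprn_gt0//.
rewrite -expr_div_n ltW// Hm1//.
by rewrite /m leqW// leq_maxl.
Qed.

Lemma spectral_radius_ge0 (M : 'M[R]_d) : 0 <= spectral_radius M.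
Proof.
rewrite /spectral_radius; set S := [set _ | _ in _].
(* [sup] is 0 by default on a set that is empty or unbounded. *)
have [H|H] := pselect (has_sup S); last by rewrite sup_out.
have [[_ [z zM _]] ub] := H.
apply: (le_trans (normc_ge0 z)).
by apply: ub_le_sup; [exact: ub | exists z].
Qed.

Lemma spectral_radius_root_le_rho_p (c : seq 'I_N) : uniq c -> (0 < size c)%N ->
  ((spectral_radius (word_prod A c) `^ ((size c)%:R^-1))%:E <= rho_p nrm A)%E.
Proof.
move=> c_uniq c_gt0.
have [r r0 Er] := rho_d_fin A nrmP.
have rp0 : (0%:E <= rho_p nrm A)%E.
  apply: le_trans (rho_p_markov_ge0 A nrm (@cycle_mx_stochastic R N c)
    (cycle_nu_invariant c_uniq c_gt0)) _.
  apply: ereal_sup_ubound; exists (cycle_nu c, cycle_mx c) => //=; split.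
    exact: cycle_mx_stochastic.
  exact: cycle_nu_invariant.
have fin : rho_p nrm A \is a fin_num.
  rewrite fin_numE -ltey -ltNye (lt_le_trans _ rp0) ?ltNyr//.
  by rewrite (le_lt_trans (rho_p_le_rho_d A nrm))// Er ltry.
have H z := @eigenvalue_root_le_rho_p c z c_uniq c_gt0.
move: rp0 H; rewrite -(fineK fin) lee_fin; set rp := fine _ => rp0 H.
rewrite lee_fin root_le ?spectral_radius_ge0// /spectral_radius.
set S := [set _ | _ in _].
have [[x Sx]|S0] := pselect (S !=set0); last first.
  by rewrite sup_out ?exprn_ge0// => -[].
apply: ge_sup; first by exists x.
by move=> _ [z /= zc <-]; have := H z zc; rewrite lee_fin root_le ?normc_ge0.
Qed.

(** The supremum is an upper bound because the moduli are bounded, here through [rho_p] and the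
    finite [rho_d]. *)
Lemma eigenvalue_le_spectral_radius (c : seq 'I_N) (z : R[i]) :
    uniq c -> (0 < size c)%N ->
    eigenvalue (map_mx (real_complex R) (word_prod A c)) z ->
  normc z <= spectral_radius (word_prod A c).
Proof.
move=> c_uniq c_gt0 zc; have [r r0 Er] := rho_d_fin A nrmP.
apply: ub_le_sup; last by exists z.
exists (r ^+ size c) => _ [z' /= z'c <-].
have := le_trans (eigenvalue_root_le_rho_p c_uniq c_gt0 z'c) (rho_p_le_rho_d A nrm).
by rewrite Er lee_fin root_le ?normc_ge0.
Qed.

End LowerBound.

(** * The strict upper bound *)

Section GreedyCycle.
Context {R : realType} {N : nat}.
Hypothesis N_gt0 : (0 < N)%N.
Variables (nu : 'rV[R]_N) (P : 'M[R]_N).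
Hypotheses (Psto : stochastic P) (nuP : invariant_probability P nu).

Let v : R := N%:R^-1.
Let v_gt0 : 0 < v. Proof. by rewrite invr_gt0 ltr0n. Qed.
Let v_le1 : v <= 1.
Proof. by rewrite invf_le1 ?ltr0n// ler1n. Qed.

Lemma exists_ge_average (a : 'I_N -> R) : \sum_i a i = 1 -> exists i, v <= a i.
Proof.
move=> a1; apply: contrapT => na.
have lt i : a i < v by rewrite ltNge; apply/negP => va; apply: na; exists i.
have : \sum_(i < N) v <= \sum_i a i.
  by rewrite a1 sumr_const card_ord /v -[leLHS]mulr_natr mulVf// pnatr_eq0 -lt0n.
rewrite leNgt => /negP; apply.
rewrite (bigD1 (Ordinal N_gt0))//= [ltRHS](bigD1 (Ordinal N_gt0))//=.
by apply: ltr_leD => //; apply: ler_sum => i _; exact: ltW.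
Qed.

(** By stationarity the mass of [f j] is at least that of [j] times [P j (f j)], so each step loses
    at most a factor [v]. *)
Lemma greedy_walk (f : 'I_N -> 'I_N) i n : (forall j, v <= P j (f j)) ->
  v <= nu 0 i -> v ^+ n.+1 <= nu 0 (iter n f i).
Proof.
move=> fP nui; elim: n => [|n IH]; first by rewrite expr1.
rewrite iterS exprSr; set j := iter n f i in IH *.
case: nuP => nu0 _ nuE; have -> : nu 0 (f j) = (nu *m P) 0 (f j) by rewrite -nuE.
rewrite mxE (bigD1 j)//=.
rewrite (@le_trans _ _ (nu 0 j * P j (f j)))//.
  by rewrite ler_pM ?exprn_ge0 ?(ltW v_gt0).
rewrite lerDl sumr_ge0// => k _; rewrite mulr_ge0//; by case: Psto.
Qed.

Lemma path_weight_traject (f : 'I_N -> 'I_N) x n : (forall j, v <= P j (f j)) ->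
  nu 0 x * v ^+ n <= path_weight nu P (traject f x n.+1).
Proof.
move=> fP; rewrite ler_wpM2l//; first by case: nuP.
elim: n x => [|n IH] x; first by rewrite /= big_nil.
rewrite trajectS /= big_cons exprS ler_pM ?exprn_ge0 ?(ltW v_gt0)//.
exact: IH.
Qed.

(** The orbit of a heavy state under the most likely transitions enters a simple cycle. Its length
    divides [N!], so turning along it for [m * N!] letters spells a power of it. *)
Lemma likely_cycle_word m : (0 < m)%N -> exists c : seq 'I_N,
  [/\ uniq c, (0 < size c)%N &
      v ^+ (N.+1 + m * N`!)
        <= path_weight nu P (word_pow (word_pow c (N`! %/ size c)) m)].
Proof.
move=> m0.
have exP i : exists j, v <= P i j by apply: exists_ge_average; case: Psto.
have [f fP] := choice exP.
have [i0 Hi0] : exists i, v <= nu 0 i by apply: exists_ge_average; case: nuP.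
have /trajectP [j jo itj] := looping_order f i0.
set x := iter j f i0 in itj; set k := (order f i0 - j)%N.
have jk : (order f i0 = j + k)%N by rewrite subnKC// ltnW.
have fx : iter k f x = x by rewrite -iterD addnC -jk itj.
have oN : (order f i0 <= N)%N.
  by rewrite -size_orbit -(card_uniqP (orbit_uniq f i0)) -[leqRHS](card_ord N) max_card.
have k0 : (0 < k)%N by rewrite subn_gt0.
have kN : (k <= N)%N by rewrite (leq_trans (leq_subr _ _)).
exists (traject f x k); split; rewrite ?size_traject//.
  have := orbit_uniq f i0; rewrite /orbit jk trajectD cat_uniq.
  by case/and3P.
have -> : word_pow (word_pow (traject f x k) (N`! %/ k)) m = traject f x (m * N`!).
  rewrite -word_powM /word_pow -traject_period// -mulnA divnK//.
  by apply: dvdn_fact; rewrite k0.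
have T0 : (0 < m * N`!)%N by rewrite muln_gt0 m0 fact_gt0.
(* Reaching the cycle costs at most [N.+1] factors [v], and a word of [m * N!] letters has one
   transition fewer. *)
rewrite -[in leRHS](prednK T0); apply: le_trans (path_weight_traject _ _ fP).
rewrite exprD ler_pM ?exprn_ge0 ?(ltW v_gt0)//.
  apply: le_trans (greedy_walk _ fP Hi0).
  by rewrite ler_wiXn2l ?(ltW v_gt0)// ltnS (leq_trans (ltnW jo)).
by rewrite ler_wiXn2l ?(ltW v_gt0)// leq_pred.
Qed.

Lemma markov_mean_le_likely_word n g (a b c : R) u :
    (forall w, size w = n -> g w <= a) -> size u = n -> g u <= b -> b <= a ->
    c <= path_weight nu P u ->
  markov_mean nu P n g <= a - c * (a - b).
Proof.
move=> ga /eqP un gb ba cu.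
(* Majorise [g] by [a], lowered to [b] at the single word [u]. *)
apply: (@le_trans _ _ (markov_mean nu P n (fun w => 1 * a + - (a - b) * (w == u)%:R))).
  apply: markov_mean_le => // w sw; case: eqP => [->|_]; last first.
    by rewrite mulr0 addr0 mul1r ga.
  by rewrite mulr1 mul1r opprB addrC subrK.
rewrite markov_mean_lin (markov_mean_cst Psto nuP) mul1r lerD2l mulNr lerN2 mulrC.
rewrite ler_wpM2l ?subr_ge0// (le_trans cu)// /markov_mean.
rewrite (bigD1 (Tuple un))//= eqxx mulr1 lerDl sumr_ge0// => w _.
by rewrite mulr_ge0 ?path_weight_ge0.
Qed.

End GreedyCycle.

(** * Normalised products and a gap uniform in the chain *)

Section StrictUpperBound.
Context {R : realType} {d N : nat} (A : 'I_N -> 'M[R]_d) (nrm : 'cV[R]_d -> R).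
Hypotheses (N_gt0 : (0 < N)%N) (nrmP : is_vector_norm nrm).
Variable r : R.
Hypotheses (r_gt0 : 0 < r) (rhoE : rho_d nrm A = r%:E).

Let A' i := r^-1 *: A i.
Let r0 := lt0r_neq0 r_gt0.

Lemma mnorm_normalized w :
  mnorm (word_prod A' w) = r ^- size w * mnorm (word_prod A w).
Proof.
by rewrite word_prodZ mnormZ exprVn gtr0_norm// invr_gt0 exprn_gt0.
Qed.

(** Long words are controlled by [rho_d < r * s]; the remaining lengths are bounded and absorbed by
    the constant. *)
Lemma subexponential_normalized : subexponential A'.
Proof.
move=> s s1; have s0 := lt_trans ltr01 s1.
have [|n0 Hn0] := @rho_d_word_bound _ _ _ A nrm nrmP (r * s) (mulr_gt0 r_gt0 s0).
  by rewrite rhoE lte_fin -[ltLHS]mulr1 ltr_pM2l.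
have [C C0 HC] := mnorm_le_induced_norm nrmP.
have [K [M [K0 M1 HKM]]] := word_prod_exp_bound A'.
have M0 := lt_le_trans ltr01 M1.
have KM0 : 0 <= K * M ^+ n0 by rewrite mulr_ge0 ?exprn_ge0 ?(ltW K0) ?(ltW M0).
exists (C + K * M ^+ n0) => w.
have sw0 : 0 <= s ^+ size w by rewrite exprn_ge0// ltW.
have [wn0|n0w] := leqP (size w) n0.
  rewrite (le_trans (HKM w))// (@le_trans _ _ (K * M ^+ n0))//.
    by rewrite ler_wpM2l ?(ltW K0)// ler_weXn2l.
  rewrite (@le_trans _ _ (C + K * M ^+ n0))//; first by rewrite lerDr ltW.
  by rewrite ler_peMr ?addr_ge0 ?(ltW C0)// exprn_ege1// ltW.
rewrite mnorm_normalized ler_pdivrMl ?exprn_gt0//.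
rewrite (le_trans (HC _))// mulrCA -exprMn.
rewrite ler_pM ?(ltW C0) ?induced_norm_ge0 ?Hn0//.
by rewrite lerDl.
Qed.

(** The powers of the product grow at most like [s ^+ n] with [s] midway between its spectral radius
    and [r ^+ k], and normalising divides by [r ^+ (k * n)]. *)
Lemma spectral_gap_decay (c : seq 'I_N) : uniq c -> (0 < size c)%N ->
    spectral_radius (word_prod A c) `^ ((size c)%:R^-1) < r ->
  exists K q, [/\ 0 <= q < 1 &
    forall n, mnorm (word_prod A' (word_pow c n)) <= K * q ^+ n].
Proof.
move=> c_uniq c_gt0; set sr := spectral_radius _; set k := size c in c_gt0 *.
have sr0 : 0 <= sr := spectral_radius_ge0 _.
rewrite root_lt ?(ltW r_gt0)// => srr; have rk0 : 0 < r ^+ k by apply: exprn_gt0.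
pose s := (sr + r ^+ k) / 2.
have srs : 0 <= sr < s by rewrite sr0 /s; lra.
have [K HK] := eigenvalues_geometric_bound srs
  (fun z => @eigenvalue_le_spectral_radius _ _ _ A nrm nrmP c z c_uniq c_gt0).
exists K, (s / r ^+ k); split=> [|n].
  have /andP[_ sr_s] := srs; rewrite divr_ge0 ?(ltW rk0) ?(le_trans sr0 (ltW sr_s))//=.
  by rewrite ltr_pdivrMr// mul1r /s; lra.
rewrite mnorm_normalized ler_pdivrMl ?exprn_gt0// size_word_pow word_prod_pow.
rewrite mulnC exprM expr_div_n mulrCA [X in K * X]mulrCA mulfV ?mulr1 ?HK//.
by rewrite lt0r_neq0// exprn_gt0.
Qed.

(** Repetition brings all simple cycles to the common length [N!]. *)
Definition cycle_words : set (seq 'I_N) :=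
  [set w | exists2 c, uniq c /\ (0 < size c)%N & w = word_pow c (N`! %/ size c)].

Lemma size_uniq_ord (c : seq 'I_N) : uniq c -> (size c <= N)%N.
Proof. by move=> /card_uniqP <-; rewrite -[leqRHS](card_ord N) max_card. Qed.

Lemma size_cycle_word w : cycle_words w -> size w = N`!.
Proof.
move=> [c [c_uniq c_gt0] ->]; rewrite size_word_pow divnK// dvdn_fact//.
by rewrite c_gt0 size_uniq_ord.
Qed.

Hypothesis gap : forall c : seq 'I_N, uniq c -> (0 < size c)%N ->
  spectral_radius (word_prod A c) `^ ((size c)%:R^-1) < r.

(** There are finitely many words of length [N!], so the largest rate and the sum of the constants
    serve all of them; words that are not cycle words receive zeros. *)
Lemma decaying_normalized : decaying cycle_words A'.
Proof.
have H (w : N`!.-tuple 'I_N) : exists Kq : R * R, 0 <= Kq.2 < 1 /\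
    (cycle_words w -> forall m,
      mnorm (word_prod A' (word_pow w m)) <= Kq.1 * Kq.2 ^+ m).
  have [[c [c_uniq c_gt0] ->]|nw] := pselect (cycle_words w); last first.
    by exists (0, 0); split=> //=; rewrite lexx ltr01.
  have [K [q [q01 HK]]] := spectral_gap_decay c_uniq c_gt0 (gap c_uniq c_gt0).
  exists (`|K|, q); split=> //= _ m; rewrite -word_powM (le_trans (HK _))//.
  have /andP[q0 q1] := q01.
  apply: (@le_trans _ _ (`|K| * q ^+ (m * (N`! %/ size c)))).
    by rewrite ler_wpM2r ?exprn_ge0// ler_norm.
  rewrite ler_wpM2l// ler_wiXn2l ?(ltW q1)// leq_pmulr// divn_gt0//.
  by rewrite dvdn_leq ?fact_gt0// dvdn_fact// c_gt0 size_uniq_ord.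
have [Kq HKq] := choice H.
pose q := \big[Num.max/0]_w (Kq w).2.
exists (\sum_w `|(Kq w).1|), q; split.
  rewrite bigmax_ge_id /=; apply/bigmax_ltP; split=> // w _.
  by have [/andP[]] := HKq w.
move=> w m Ww; have /eqP sw := size_cycle_word Ww.
have [/andP[q0 _] /(_ Ww m)] := HKq (Tuple sw); move/le_trans; apply.
apply: (@le_trans _ _ (`|(Kq (Tuple sw)).1| * q ^+ m)).
  apply: (@le_trans _ _ (`|(Kq (Tuple sw)).1| * (Kq (Tuple sw)).2 ^+ m)).
    by rewrite ler_wpM2r ?exprn_ge0// ler_norm.
  rewrite ler_wpM2l// lerXn2r ?nnegrE// ?bigmax_ge_id//.
  exact: (le_bigmax _ (fun w => (Kq w).2)).
rewrite ler_wpM2r ?exprn_ge0 ?bigmax_ge_id// (bigD1 (Tuple sw))//= lerDl.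
exact: sumr_ge0.
Qed.

(* In an adapted norm every word of length [T] has norm at most about [r ^ T],
   and the likely cycle word, of weight at least [c], definitely less. *)
Lemma rho_p_lt : exists2 r', r' < r & (rho_p nrm A <= r'%:E)%E.
Proof.
have [m0 Hm0] := subexponential_adapted_norms subexponential_normalized
  decaying_normalized.
pose m := m0.+1; pose T := (m * N`!)%N.
have T0 : (0 < T)%N by rewrite muln_gt0 fact_gt0.
pose c : R := N%:R^-1 ^+ (N.+1 + T).
have c0 : 0 < c by rewrite exprn_gt0// invr_gt0 ltr0n.
(* With [delta <= 1 / 4], the contracted words have norm at most [1 / 2 + delta <= 3 / 4], whose
   root of order [T] is [theta]. *)
pose theta : R := (3 / 4) `^ (T%:R^-1).
have theta0 : 0 <= theta by apply: powR_ge0.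
have theta1 : theta < 1 by rewrite root_lt// ?expr1n; lra.
have thetaT : theta ^+ T = 3 / 4 by rewrite root_exprK//; lra.
(* The loss [delta] over all words must stay below the gain [c * (1 - theta)] from the contracted
   one; half of the gain is kept. *)
pose delta : R := Num.min (1 / 4) (c * (1 - theta) / 2).
have c1 : 0 < c * (1 - theta) by rewrite mulr_gt0// subr_gt0.
have delta0 : 0 < delta by rewrite lt_min !divr_gt0.
have delta1 : delta <= 1 / 4 by rewrite ge_min lexx.
have delta2 : delta <= c * (1 - theta) / 2 by rewrite ge_min lexx orbT.
have [p [pP pT pW]] := Hm0 m T delta (leqnSn _) delta0.
exists (r * (1 - c * (1 - theta) / 2)).
  by rewrite -[ltRHS]mulr1 ltr_pM2l// ltrBlDr ltrDl divr_gt0.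
have root_bound (b e : R) w : size w = T -> 0 <= b -> e <= b ^+ T -> 0 <= e ->
    (forall x, p (word_prod A' w *m x) <= e * p x) ->
    induced_norm p (word_prod A w) `^ (T%:R^-1) <= r * b.
  move=> sw b0 eb e0 Hw.
  rewrite root_le ?induced_norm_ge0 ?mulr_ge0 ?(ltW r_gt0)// exprMn.
  apply: (@le_trans _ _ (r ^+ T * e)); last by rewrite ler_wpM2l ?exprn_ge0 ?(ltW r_gt0).
  apply: induced_norm_le => // [x|]; last by rewrite mulr_ge0 ?exprn_ge0 ?(ltW r_gt0).
  have := Hw x; rewrite word_prodZ sw -scalemxAl (vnormZ pP) exprVn.
  by rewrite gtr0_norm ?invr_gt0 ?exprn_gt0// ler_pdivrMl ?exprn_gt0// mulrA.
apply: ge_ereal_sup => _ [[nu P] /= [Psto nuP] <-].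
apply: le_trans (rho_p_markov_le _ Psto nuP nrmP pP T0) _; rewrite lee_fin.
have [cc [cc_uniq cc_gt0 ccw]] := likely_cycle_word N_gt0 Psto nuP (ltn0Sn m0).
set u := word_pow _ m in ccw.
have Wu : cycle_words (word_pow cc (N`! %/ size cc)) by exists cc.
have uT : size u = T by rewrite size_word_pow (size_cycle_word Wu).
apply: (@le_trans _ _ (r * (1 + delta) - c * (r * (1 + delta) - r * theta))).
  apply: (markov_mean_le_likely_word Psto nuP _ uT _ _ ccw) => [w sw||].
  - apply: (root_bound _ (1 + delta)) => //; last by move=> x; apply: pT.
    + by rewrite addr_ge0// ltW.
    + by rewrite -[leLHS]expr1 ler_weXn2l// lerDl ltW.
    + by rewrite addr_ge0// ltW.
  - apply: (root_bound _ (1 / 2 + delta)) => //; last by move=> x; apply: pW.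
    + by rewrite thetaT; lra.
    + by rewrite addr_ge0// ?divr_ge0// ltW.
  - by rewrite ler_pM2l// (le_trans (ltW theta1))// lerDl ltW.
rewrite (_ : _ - _ = r * (1 + delta - c * (1 + delta - theta))); last by ring.
rewrite ler_pM2l//.
have := mulr_ge0 (ltW c0) (ltW delta0); lra.
Qed.

End StrictUpperBound.

(** * The equivalence, from the two bounds on [rho_p] *)

Theorem theorem3p13 (R : realType) (d N : nat) (d_gt0 : (0 < d)%N)
    (N_gt0 : (0 < N)%N) (nrm : 'cV[R]_d -> R) (nrmP : is_vector_norm nrm)
    (A : 'I_N -> 'M[R]_d) :
  rho_d nrm A = rho_p nrm A <->
  exists (k : nat) (w : k.-tuple 'I_N),
    [/\ (0 < k)%N, uniq w &
        rho_d nrm A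
        = ((spectral_radius (word_prod A w)) `^ (k%:R^-1))%:E].
Proof.
split=> [dp|[k [w [k0 w_uniq Ed]]]]; last first.
  apply/eqP; rewrite eq_le rho_p_le_rho_d andbT Ed.
  have := @spectral_radius_root_le_rho_p _ _ _ A _ nrmP w w_uniq.
  by rewrite size_tuple; apply.
apply: contrapT => nb.
have [r r0 Er] := rho_d_fin A nrmP.
have gap (c : seq 'I_N) : uniq c -> (0 < size c)%N ->
    spectral_radius (word_prod A c) `^ ((size c)%:R^-1) < r.
  move=> c_uniq c_gt0; rewrite lt_neqAle; apply/andP; split.
    by apply/eqP => sr; apply: nb; exists (size c), (in_tuple c); split;
      rewrite ?Er ?sr.
  have := spectral_radius_root_le_rho_p A nrmP c_uniq c_gt0.
  by rewrite -dp Er lee_fin.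
(* The gap for a one-letter cycle puts a nonnegative root strictly below [r]. *)
have r_gt0 : 0 < r.
  exact: le_lt_trans (powR_ge0 _ _) (gap [:: Ordinal N_gt0] isT isT).
have [r' r'r] := rho_p_lt N_gt0 nrmP r_gt0 Er gap.
by rewrite -dp Er lee_fin leNgt r'r.
Qed.
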